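(* For every integer $s \ge 10$, there exist wonderful rays in $N^1(X_s)$. For every $s\ge 13$, there exist wonderful rays $R$ in $N^1(X_s)$ with $R\cdot K_s>0$. For $s=14$, for every $s\ge 13$ such that $s-4$ is a perfect square, and for every $s\ge 18$ such that $s-2$ is a perfect square, there exist De Fernex negative wonderful rays in $N^1(X_s)$.
   Context: $X_s$ denotes the blow-up of the complex projective plane at $s$ very general points; $H$ is the pullback of a line and $E_1,\dots,E_s$ are the exceptional divisors, so $\mathrm{Pic}(X_s)=\mathbb Z H\oplus\bigoplus_i \mathbb Z E_i$ with $H^2=1$, $E_i^2=-1$, $H\cdot E_i=E_i\cdot E_j=0$ ($i\ne j$). $N=N^1(X_s)=\mathrm{Pic}(X_s)\otimes_{\mathbb Z}\mathbb R$. A ray is the set of non-negative real multiples of a nonzero vector of $N$; it is rational if it contains a nonzero integral vector, irrational otherwise; it is effective if it contains an integral vector representing an effective divisor class. The degree of $dH-\sum m_iE_i$ is $d$ (its sign is well defined on rays). The Mori cone is the closure of the cone spanned by effective classes; a ray is nef if it meets every effective divisor non-negatively. A good ray is a rational, non-effective ray of non-negative degree and self-intersection zero. A wonderful ray is a nef, irrational ray of self-intersection zero. $K_s=-3H+\sum_{i=1}^s E_i$ is the canonical class. The De Fernex ray $F_s$ is the ray spanned by $\sqrt{s-1}\,H-\sum_{i=1}^sE_i$; a ray $R$ is De Fernex negative if $R\cdot F_s<0$. *)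

(* Defs.v *)
From mathcomp Require Import all_boot all_order all_algebra.
From mathcomp Require Import reals Rstruct.
From mathcomp Require Import complex.

Set Implicit Arguments.
Unset Strict Implicit.
Unset Printing Implicit Defensive.

Import Order.TTheory GRing.Theory Num.Theory.
Local Open Scope ring_scope.

Notation RR := Rdefinitions.R.
Notation CC := (Rdefinitions.R)[i].

(* An affine plane polynomial f of degree <= d is given by its coefficient *)
(* function c : nat -> nat -> CC, f = \sum c i j x^i y^j, with c i j = 0   *)
(* whenever i + j > d.                                                     *)

(* Coefficient of X^a Y^b in the Taylor expansion f(x + X, y + Y) of f at  *)
(* the point p = (x, y).                                                  *)
Definition taylor_coef (d : nat) (c : nat -> nat -> CC) (p : CC * CC)
    (a b : nat) : CC :=
  \sum_(i < d.+1) \sum_(j < d.+1)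
     c i j * ('C(i, a))%:R * ('C(j, b))%:R * p.1 ^+ (i - a) * p.2 ^+ (j - b).

(* f has multiplicity >= m at p (vacuous when m <= 0). *)
Definition mult_ge (d : nat) (c : nat -> nat -> CC) (p : CC * CC) (m : int) :=
  forall a b : nat, ((a + b)%N%:Z < m)%R -> taylor_coef d c p a b = 0.

Definition effective (s : nat) (d : int) (m : 'I_s -> int) : Prop :=
  (0 <= d)%R /\
  forall p : 'I_s -> CC * CC, injective p ->
    exists c : nat -> nat -> CC,
      [/\ (forall i j, (`|d| < i + j)%N -> c i j = 0),
          (exists i j, c i j != 0) &
          forall k, mult_ge `|d| c (p k) (m k)].

(* N^1(X_s) = R^{1+s}: the vector (d, m) stands for dH - \sum_i m_i E_i.   *)
Definition NS (s : nat) : Type := (RR * ('I_s -> RR))%type.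

Definition dotN (s : nat) (v w : NS s) : RR :=
  v.1 * w.1 - \sum_(i < s) v.2 i * w.2 i.

Definition nonzeroN (s : nat) (v : NS s) : Prop :=
  v.1 != 0 \/ exists i, v.2 i != 0.

Definition classN (s : nat) (d : int) (m : 'I_s -> int) : NS s :=
  (d%:~R, fun i => (m i)%:~R).

Definition rational_ray (s : nat) (v : NS s) : Prop :=
  exists (l : RR) (d : int) (m : 'I_s -> int),
    [/\ 0 < l, l * v.1 = d%:~R & forall i, l * v.2 i = (m i)%:~R].

Definition nef_ray (s : nat) (v : NS s) : Prop :=
  forall (d : int) (m : 'I_s -> int),
    effective d m -> 0 <= dotN v (classN d m).

Definition wonderful (s : nat) (v : NS s) : Prop :=
  [/\ nonzeroN v, nef_ray v, ~ rational_ray v & dotN v v = 0].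

Definition canonicalN (s : nat) : NS s := (-3, fun _ => -1).

Definition deFernexN (s : nat) : NS s := (Num.sqrt ((s - 1)%N%:R), fun _ => 1).

(* Main.v *)
Require Import Defs.
From mathcomp Require Import all_boot all_order all_algebra.
From mathcomp Require Import reals Rstruct.
From mathcomp Require Import complex.
From mathcomp Require Import boolp fraction ring lra zify.
(** Wonderful rays are produced in X_10 and then moved to more points.

    On X_10 every isotropic v orthogonal to K with v0 >= 0 is nef: a quadratic
    Cremona map lowering the degree of an effective D transforms the pair
    (D, v) and keeps D.v, and once no such map exists D + eK has non-negative
    square for e the least multiplicity of D, so D.v = (D + eK).v >= 0 by
    Cauchy-Schwarz.  The family
      (15M^2+6; 9M^2, 4M^2+2 + 3M sqrt 2, 4M^2+2 - 3M sqrt 2, (4M^2+2)^7)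
    consists of irrational such v.

    Nefness is preserved by Cremona maps, by adding points of multiplicity 0,
    and by replacing a point of multiplicity a by k^2 points of multiplicity
    a/k: letting k^2 points collide in the shape of a k x k grid, a curve with
    multiplicities n_ij there degenerates to one of multiplicity at least
    (sum n_ij)/k at the limit, because the limit of the rescaled equation has
    degree at most that multiplicity and k lines cover the grid.

    Writing h = v0 - m0, each Jonquieres step (v0; m0, ..) -> (v0 + h; m0 + h,
    .., h, h) adds two points.  With M = k, s = k^2+4 is reached by k-3 steps
    and s = k^2+2 by k-4 steps, followed by spreading m0 over (k-1)^2 points;
    s = 14 by one Cremona map involving a new point and spreading over 4. *)

Set Implicit Arguments.
Unset Strict Implicit.
Unset Printing Implicit Defensive.
Import Order.TTheory GRing.Theory Num.Theory.
Local Open Scope ring_scope.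

(** * Kernels of matrices depending polynomially on a parameter *)

Section Kernel.
Variable F : numFieldType.
Implicit Types (p q : {poly F}).

Lemma exists_nonroot q : q != 0 -> exists e, q.[e] != 0.
Proof.
move=> q0; pose s : seq F := [seq i%:R | i <- iota 0 (size q)].
have us : uniq s.
  rewrite map_inj_uniq ?iota_uniq // => i j /eqP; by rewrite eqr_nat => /eqP.
case: (boolP (all (root q) s)) => [rs|].
  by have := max_poly_roots q0 rs us; rewrite size_map size_iota ltnn.
by rewrite -has_predC => /hasP[e _ /= /rootP/eqP]; exists e.
Qed.

Lemma poly_eq0_horner q : (forall e, q.[e] = 0) -> q = 0.
Proof.
move=> h; apply/eqP/negPn/negP => /exists_nonroot[e]; by rewrite h eqxx.
Qed.

Lemma fraction_clear (R : idomainType) (x : {fraction R}) :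
  exists2 q : R, q != 0 & exists g, FracField.tofrac q * x = FracField.tofrac g.
Proof.
elim/quotW: x => x; exists (\d_x); first exact: denom_ratioP.
exists (\n_x); unlock FracField.tofrac; rewrite -[LHS]FracField.pi_mul.
apply/eqmodP => /=; rewrite /FracField.mulf FracField.equivfE.
rewrite !numden_Ratio ?oner_neq0 ?mulf_neq0 ?denom_ratioP ?oner_neq0 //.
by rewrite !mul1r mulr1.
Qed.

Lemma clear_denominators (R : idomainType) (I : finType)
    (f : I -> {fraction R}) :
  exists2 q : R, q != 0 & exists g : I -> R,
    forall i, FracField.tofrac q * f i = FracField.tofrac (g i).
Proof.
have /fin_all_exists2[a a0 /fin_all_exists [b hb]] : forall i, exists2 q : R,
  q != 0 & exists g, FracField.tofrac q * f i = FracField.tofrac g.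
  by move=> i; exact: fraction_clear.
exists (\prod_i a i); first by apply/prodf_neq0 => i _; apply: a0.
exists (fun i => \prod_(j | j != i) a j * b i) => i.
by rewrite (bigD1 i) //= mulrC rmorphM mulrCA mulrA hb mulrC -rmorphM.
Qed.

(** Normalises a one-parameter family so that its member at parameter 0 is nonzero. The size of one
    fixed nonzero entry drops at each division by X. *)
Lemma extract_Xn (U : finType) (g : U -> {poly F}) :
  (exists u, g u != 0) -> exists r (h : U -> {poly F}),
    (forall u, g u = 'X^r * h u) /\ exists u, (h u).[0] != 0.
Proof.
case=> u0; have [n] := ubnP (size (g u0)); elim: n g => // n IH g.
rewrite ltnS => sz g0.
case: (boolP [exists u, (g u).[0] != 0]) => [/existsP h|].
  by exists 0, g; split=> // u; rewrite expr0 mul1r.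
rewrite negb_exists => /forallP h.
have /fin_all_exists[g' hg] : forall u, exists f, g u = 'X * f.
  move=> u; have /factor_theorem[f ->] : root (g u) 0.
    by apply/rootP/eqP; move: (h u); rewrite negbK.
  by exists f; rewrite subr0 mulrC.
have g'0 : g' u0 != 0.
  by apply: contraNneq g0 => g'0; rewrite hg g'0 mulr0.
have [|r [k [hk k0]]] := IH g' _ g'0.
  by move: sz; rewrite hg mulrC size_mulX.
exists r.+1, k; split=> // u; by rewrite hg hk mulrA -exprS.
Qed.

(* Over the field of fractions either the rows are free, and then they remain
   free at every value of the parameter where the denominators of a right
   inverse do not vanish, or there is a kernel vector. *)
Lemma poly_kernel (U V : finType) (A : U -> V -> {poly F}) (q : {poly F}) :
    q != 0 ->
    (forall e, q.[e] != 0 -> exists2 w : U -> F, exists u, w u != 0 &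
       forall v, \sum_u w u * (A u v).[e] = 0) ->
  exists2 w : U -> {poly F}, exists u, (w u).[0] != 0 &
    forall v, \sum_u w u * A u v = 0.
Proof.
move=> q0 hq;
  pose tf : {rmorphism {poly F} -> {fraction {poly F}}} := @FracField.tofrac _.
have tf_inj : injective tf by move=> x y /eqP; rewrite tofrac_eq => /eqP.
pose M := \matrix_(i < #|U|, j < #|V|) tf (A (enum_val i) (enum_val j)).
case: (boolP (row_free M)) => [/row_freeP[B MB]|].
  have [q' q'0 [b hb']] := clear_denominators (fun ij => B ij.1 ij.2).
  have hb ij : tf q' * B ij.1 ij.2 = tf (b ij) := hb' ij.
  have [e] : exists e, (q * q').[e] != 0 by apply/exists_nonroot/mulf_neq0.
  rewrite hornerM mulf_eq0 negb_or => /andP[qe q'e].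
  have [w [u wu] hw] := hq e qe.
  have hAb u' : \sum_j A u' (enum_val j) * b (j, enum_rank u)
                = if u' == u then q' else 0.
    apply: tf_inj; rewrite rmorph_sum /=.
    move/matrixP: (MB) => /(_ (enum_rank u') (enum_rank u)).
    rewrite !mxE => /(congr1 (fun x => tf q' * x)).
    rewrite mulr_sumr (inj_eq enum_rank_inj) => h.
    transitivity (tf q' * (u' == u)%:R); last first.
      by case: eqP => _; rewrite ?mulr1 ?mulr0 ?rmorph0.
    rewrite -h; apply: eq_bigr => j _.
    by rewrite rmorphM /= -(hb (j, enum_rank u)) /= mxE enum_rankK mulrCA.
  (* Pairing the relation [w] at [e] with column [u] of the cleared right inverse leaves exactly
     this product, which is nonzero by the choice of [u] and [e]. *)
  suff : w u * q'.[e] == 0 by rewrite mulf_eq0 (negPf wu) (negPf q'e).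
  have -> : w u * q'.[e] = \sum_u' w u' * (if u' == u then q' else 0).[e].
    rewrite (bigD1 u) //= eqxx big1 ?addr0 // => u' /negPf ->.
    by rewrite horner0 mulr0.
  apply/eqP; under eq_bigr => u' _ do rewrite -hAb horner_sum mulr_sumr.
  rewrite exchange_big big1 //= => j _.
  transitivity ((\sum_u' w u' * (A u' (enum_val j)).[e])
                * (b (j, enum_rank u)).[e]); last by rewrite hw mul0r.
  by rewrite mulr_suml; apply: eq_bigr => u' _; rewrite hornerM mulrA.
rewrite -kermx_eq0 => /rowV0Pn[x /sub_kermxP xM x0].
have [q' q'0 [g hg']] := clear_denominators (fun i => x 0 i).
have hg i : tf q' * x 0 i = tf (g i) := hg' i.
have hgA v : \sum_u g (enum_rank u) * A u v = 0.
  apply: tf_inj; rewrite rmorph_sum rmorph0 /=.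
  transitivity (tf q' * (x *m M) 0 (enum_rank v)); last by rewrite xM mxE mulr0.
  rewrite mxE mulr_sumr (reindex (@enum_val U predT)) /=; last first.
    by apply: onW_bij; exact: enum_val_bij.
  apply: eq_bigr => i _.
  by rewrite rmorphM /= enum_valK -(hg i) mxE enum_rankK mulrA.
have [|r [h [gh h0]]] := @extract_Xn U (fun u => g (enum_rank u)).
  have /existsP[i xi] : [exists i, x 0 i != 0].
    apply: contraR x0; rewrite negb_exists => /forallP h; apply/eqP/rowP => i.
    by apply/eqP; move: (h i); rewrite negbK mxE.
  exists (enum_val i); rewrite enum_valK -(inj_eq tf_inj) -hg rmorph0.
  apply: mulf_neq0 xi; rewrite -(rmorph0 tf) (inj_eq tf_inj); exact: q'0.
exists h => // v; have /eqP := hgA v.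
under eq_bigr => u _ do rewrite gh -mulrA.
by rewrite -mulr_sumr mulf_eq0 expf_eq0 polyX_eq0 andbF => /eqP.
Qed.

End Kernel.

(** * Plane forms, Taylor coefficients and multiplicities *)

Section Forms.
Variable F : numFieldType.
Implicit Types (c : nat -> nat -> F) (G : F -> F -> F -> F).

Definition supported (R : nzRingType) (d : nat) (c : nat -> nat -> R) :=
  forall i j, (d < i + j)%N -> c i j = 0.

Definition taylor (R : comNzRingType) d (c : nat -> nat -> R) (p : R * R) a b :=
  \sum_(i < d.+1) \sum_(j < d.+1)
     c i j * ('C(i, a))%:R * ('C(j, b))%:R * p.1 ^+ (i - a) * p.2 ^+ (j - b).

(** The homogenisation to degree [d]; the affine point (x, y) becomes (x : y : 1). *)
Definition form_eval d c (x y z : F) :=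
  \sum_(i < d.+1) \sum_(j < d.+1)
     c i j * x ^+ i * y ^+ j * z ^+ (d - (i + j)).

Definition isform d G :=
  exists2 c, supported d c & forall x y z, G x y z = form_eval d c x y z.

(* Vanishing to order n along every polynomial arc through the point; for a
   form this is multiplicity at least n, and it is visibly stable under
   polynomial changes of coordinates. *)
Definition mult G (x y z : F) n :=
  forall X Y Z : {poly F}, X.[0] = x -> Y.[0] = y -> Z.[0] = z ->
    exists g : {poly F}, forall t, G X.[t] Y.[t] Z.[t] = t ^+ n * g.[t].

Definition curve (I : Type) d (m : I -> nat) (p : I -> F * F) :=
  exists G, [/\ isform d G, exists x y z, G x y z != 0 &
    forall l, mult G (p l).1 (p l).2 1 (m l)].

Lemma taylor_supported (R : comNzRingType) d (c : nat -> nat -> R) p :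
  supported d c -> supported d (taylor d c p).
Proof.
move=> sc a b dab; rewrite /taylor big1 // => i _; rewrite big1 // => j _.
have [ai|ia] := ltnP i a; first by rewrite bin_small // mulr0 !mul0r.
have [bj|jb] := ltnP j b; first by rewrite (@bin_small j) // mulr0 !mul0r.
by rewrite sc ?mul0r //; lia.
Qed.

Lemma taylor_morph (R S : comNzRingType) (f : {rmorphism R -> S}) d
    (c : nat -> nat -> R) p a b :
  f (taylor d c p a b) = taylor d (fun i j => f (c i j)) (f p.1, f p.2) a b.
Proof.
rewrite /taylor rmorph_sum; apply: eq_bigr => i _; rewrite rmorph_sum.
apply: eq_bigr => j _; by rewrite !rmorphM !rmorph_nat !rmorphXn.
Qed.

Lemma taylor0 (R : comNzRingType) d (c : nat -> nat -> R) a b :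
  supported d c -> taylor d c (0, 0) a b = c a b.
Proof.
move=> sc; have [dab|dab] := ltnP d (a + b).
  by rewrite sc // (taylor_supported _ sc).
have ad : (a < d.+1)%N by lia.
have bd : (b < d.+1)%N by lia.
have z0 k l : (k < l)%N -> 0 ^+ (l - k) = 0 :> R.
  by move=> kl; rewrite expr0n subn_eq0 leqNgt kl.
rewrite /taylor (bigD1 (Ordinal ad)) //= (bigD1 (Ordinal bd)) //=.
rewrite !binn !subnn !expr0 !mulr1 !big1 ?addr0 // => [i ia|j jb].
  rewrite big1 // => j _; have [ai|ia'] := ltnP i a.
    by rewrite bin_small // mulr0 !mul0r.
  by rewrite z0 ?mulr0 ?mul0r // ltn_neqAle ia' andbT eq_sym.
have [bj|jb'] := ltnP j b; first by rewrite (@bin_small j) // mulr0 !mul0r.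
by rewrite z0 ?mulr0 // ltn_neqAle jb' andbT eq_sym.
Qed.

Lemma exprDn_wide d i (x y : F) : (i <= d)%N ->
  (x + y) ^+ i = \sum_(a < d.+1) ('C(i, a))%:R * x ^+ (i - a) * y ^+ a.
Proof.
move=> id; rewrite exprDn (big_ord_widen d.+1 (fun a => x ^+ (i - a) * y ^+ a
  *+ 'C(i, a))) //.
rewrite big_mkcond /=; apply: eq_bigr => a _.
case: ifPn; first by rewrite -mulrA mulr_natl.
by rewrite -leqNgt => h; rewrite bin_small // !mul0r.
Qed.

(** Taylor expansion about (x, y), homogenised: [s] scales the base point and [t] the displacement
    (u, v), so multiplicity shows as order in [t]. *)
Lemma form_eval_taylor d c (x y s t u v : F) : supported d c ->
  form_eval d c (s * x + t * u) (s * y + t * v) s =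
  \sum_(a < d.+1) \sum_(b < d.+1)
    taylor d c (x, y) a b * u ^+ a * v ^+ b * t ^+ (a + b) * s ^+ (d - (a + b)).
Proof.
move=> sc; rewrite /form_eval /taylor /= !pair_big /=.
under [RHS]eq_bigr => ab _ do rewrite pair_big !mulr_suml /=.
rewrite [RHS]exchange_big /=; apply: eq_bigr => -[i j] _ /=.
have [dij|dij] := ltnP d (i + j).
  by rewrite sc // !mul0r big1 // => -[a b] _ /=; rewrite !mul0r.
rewrite !(@exprDn_wide d) 1?(leq_trans _ dij) ?leq_addr ?leq_addl //.
rewrite -(mulrA (c i j)) big_distrlr /= mulr_sumr mulr_suml.
rewrite -(pair_bigA _ (fun a b : 'I_d.+1 => c i j * 'C(i, a)%:R * 'C(j, b)%:R
  * x ^+ (i - a) * y ^+ (j - b) * u ^+ a * v ^+ b * t ^+ (a + b)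
  * s ^+ (d - (a + b)))) /=.
apply: eq_bigr => a _; rewrite mulr_sumr mulr_suml; apply: eq_bigr => b _.
have [ai|ia] := ltnP i a; first by rewrite bin_small // !(mulr0, mul0r).
have [bj|jb] := ltnP j b; first by rewrite (@bin_small j) // !(mulr0, mul0r).
have -> : (d - (a + b) = (i - a) + (j - b) + (d - (i + j)))%N by lia.
by rewrite !exprMn !exprD; ring.
Qed.

Lemma form_arc G d (X Y Z : {poly F}) : isform d G ->
  exists g : {poly F}, forall t, G X.[t] Y.[t] Z.[t] = g.[t].
Proof.
case=> c _ hG; exists (\sum_(i < d.+1) \sum_(j < d.+1)
  (c i j)%:P * X ^+ i * Y ^+ j * Z ^+ (d - (i + j))) => t.
rewrite hG horner_sum; apply: eq_bigr => i _; rewrite horner_sum.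
by apply: eq_bigr => j _; rewrite !hornerM !horner_exp hornerC.
Qed.

Lemma root0_Xmul (X : {poly F}) : X.[0] = 0 -> exists U, X = 'X * U.
Proof.
move=> X0; have /factor_theorem[U ->] : root X 0 by apply/rootP.
by exists U; rewrite subr0 mulrC.
Qed.

(** Along an arc through (x : y : 1) both X - xZ and Y - yZ are divisible by the parameter, so each
    surviving Taylor term carries t^(a+b) with a + b >= n. *)
Lemma taylor_mult d c G x y n :
    supported d c -> (forall x y z, G x y z = form_eval d c x y z) ->
    (forall a b, (a + b < n)%N -> taylor d c (x, y) a b = 0) ->
  mult G x y 1 n.
Proof.
move=> sc hG ht X Y Z X0 Y0 Z0.
have [|U hU] := @root0_Xmul (X - x%:P * Z).
  by rewrite !hornerE X0 Z0 mulr1 subrr.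
have [|V hV] := @root0_Xmul (Y - y%:P * Z).
  by rewrite !hornerE Y0 Z0 mulr1 subrr.
exists (\sum_(a < d.+1) \sum_(b < d.+1) if (a + b < n)%N then 0 else
  (taylor d c (x, y) a b)%:P * U ^+ a * V ^+ b * 'X^(a + b - n)
    * Z ^+ (d - (a + b))) => t.
have eX : X.[t] = Z.[t] * x + t * U.[t].
  have := congr1 (horner^~ t) hU; rewrite !hornerE => h; rewrite -h; ring.
have eY : Y.[t] = Z.[t] * y + t * V.[t].
  have := congr1 (horner^~ t) hV; rewrite !hornerE => h; rewrite -h; ring.
rewrite hG eX eY form_eval_taylor // horner_sum mulr_sumr.
apply: eq_bigr => a _; rewrite horner_sum mulr_sumr; apply: eq_bigr => b _.
case: ltnP => [h|h]; first by rewrite ht // !mul0r horner0 mulr0.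
have -> : (t ^+ (a + b)) = t ^+ n * t ^+ (a + b - n) by rewrite -exprD subnKC.
by rewrite !hornerM !horner_exp hornerC hornerX; ring.
Qed.

Lemma mult_taylor d c G x y n a b :
    supported d c -> (forall x y z, G x y z = form_eval d c x y z) ->
  mult G x y 1 n -> (a + b < n)%N -> taylor d c (x, y) a b = 0.
Proof.
move=> sc hG hm abn; set T := taylor d c (x, y).
have sT : supported d T by exact: taylor_supported.
have [|dab] := ltnP d (a + b); first exact: sT.
(* Along t -> (x + ut, y + t) the coefficient of t^(a+b) is a polynomial in the slope [u]; it
   vanishes for every [u], so its coefficients are 0. *)
have hu (u : F) : \sum_(i < d.+1) \sum_(j < d.+1)
    (if (i + j == a + b)%N then T i j * u ^+ i else 0) = 0.
  have [||| g hg] := hm (x%:P + u *: 'X) (y%:P + 'X) 1.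
  - by rewrite !hornerE.
  - by rewrite !hornerE.
  - by rewrite hornerE.
  pose P := \sum_(i < d.+1) \sum_(j < d.+1) (T i j * u ^+ i) *: 'X^(i + j).
  have eP : P = 'X^n * g.
    apply/eqP; rewrite -subr_eq0; apply/eqP/poly_eq0_horner => t.
    rewrite hornerD hornerN; apply/eqP; rewrite subr_eq0; apply/eqP.
    rewrite [RHS]hornerM hornerXn -hg hornerC 2!hornerD !hornerC hornerZ hornerX.
    rewrite hG (_ : x + u * t = 1 * x + t * u); last by ring.
    rewrite (_ : y + t = 1 * y + t * 1); last by ring.
    rewrite form_eval_taylor // horner_sum; apply: eq_bigr => i _.
    rewrite horner_sum; apply: eq_bigr => j _.
    by rewrite hornerZ hornerXn !expr1n !mulr1.
  have := congr1 (fun p : {poly F} => p`_(a + b)) eP.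
  rewrite coefXnM abn => h; rewrite -[RHS]h coef_sum; apply: eq_bigr => i _.
  rewrite coef_sum; apply: eq_bigr => j _; rewrite coefZ coefXn eq_sym.
  by case: eqP; rewrite ?mulr1 ?mulr0.
pose Q := \sum_(i < d.+1) \sum_(j < d.+1)
    (if (i + j == a + b)%N then T i j else 0) *: 'X^i.
have : Q = 0.
  apply: poly_eq0_horner => u; rewrite -[RHS](hu u) horner_sum.
  apply: eq_bigr => i _; rewrite horner_sum; apply: eq_bigr => j _.
  by rewrite hornerZ hornerXn; case: eqP => // _; rewrite mul0r.
move/(congr1 (fun p : {poly F} => p`_a)); rewrite coef0 => h; rewrite -[RHS]h {h}.
have ad : (a < d.+1)%N by lia.
have bd : (b < d.+1)%N by lia.
rewrite coef_sum (bigD1 (Ordinal ad)) //= coef_sum (bigD1 (Ordinal bd)) //=.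
rewrite eqxx coefZ coefXn eqxx mulr1 !big1 ?addr0 // => [i ia|j jb].
  rewrite coef_sum big1 // => j _; rewrite coefZ coefXn.
  by move: ia; rewrite eq_sym; rewrite -val_eqE /= => /negPf ->; rewrite mulr0.
by rewrite eqn_add2l; move: jb; rewrite -val_eqE /= => /negPf ->;
  rewrite scale0r coef0.
Qed.

(** Forms as functions suit substitution, coefficients suit linear algebra; this translates between
    them. *)
Lemma curveP (I : Type) d (m : I -> nat) p :
  curve d m p <-> exists c, [/\ supported d c, exists i j, c i j != 0 &
    forall l a b, (a + b < m l)%N -> taylor d c (p l) a b = 0].
Proof.
split=> [[G [[c sc hG] [x [y [z Gn0]]] hm]]|[c [sc [i [j cn0]] ht]]].
  exists c; split=> // [|l a b]; last first.
    by move: (hm l); case: (p l) => u v /=; exact: mult_taylor.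
  case: (boolP [exists i : 'I_d.+1, exists j : 'I_d.+1, c i j != 0]).
    by move=> /existsP[i /existsP[j ?]]; exists i, j.
  rewrite negb_exists => /forallP h; case/negP: Gn0.
  rewrite hG /form_eval big1 // => i _; rewrite big1 // => j _.
  move: (h i); rewrite negb_exists => /forallP /(_ j).
  by rewrite negbK => /eqP ->; rewrite !mul0r.
exists (form_eval d c); split; first by exists c.
  (* A form vanishing everywhere would have every multiplicity at the origin, which would force
     [c i j] to be 0. *)
  apply: contrapT => h; case/negP: cn0; apply/eqP.
  rewrite -(taylor0 i j sc).
  apply: (@mult_taylor d c (form_eval d c) _ _ (i + j).+1) => //.
  move=> X Y Z _ _ _; exists 0 => t; rewrite horner0 mulr0.
  apply: contrapT => h'; apply: h; exists X.[t], Y.[t], Z.[t]; exact/eqP.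
by move=> l; apply: taylor_mult (sc) _ _ => // a b; rewrite -surjective_pairing;
  exact: ht.
Qed.

Definition at_param (I : Type) (p : I -> {poly F} * {poly F}) e l :=
  ((p l).1.[e], (p l).2.[e]).

(** At each parameter the curves form the kernel of a matrix with entries polynomial in that
    parameter, so [poly_kernel] applies. *)
Lemma curve_family (I : finType) d (m : I -> nat) (p : I -> {poly F} * {poly F})
    (q : {poly F}) :
    q != 0 -> (forall e, q.[e] != 0 -> curve d m (at_param p e)) ->
  exists c : nat -> nat -> {poly F}, [/\ supported d c,
    exists i j, (c i j).[0] != 0 &
    forall l a b, (a + b < m l)%N -> taylor d c (p l) a b = 0].
Proof.
move=> q0 hq; pose U := ('I_d.+1 * 'I_d.+1)%type.
(* [N] bounds every [m l], so the Taylor conditions have a finite index type; the summand [U] of [V]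
   indexes the equations that impose degree at most [d]. *)
pose N := (\sum_l m l)%N; pose V := ((I * 'I_N * 'I_N) + U)%type.
pose A (u : U) (v : V) : {poly F} := match v with
  | inl (l, a, b) => if (a + b < m l)%N then
      ('C(u.1, a))%:R * ('C(u.2, b))%:R * (p l).1 ^+ (u.1 - a) * (p l).2 ^+
        (u.2 - b)
      else 0
  | inr u' => ((u == u') && (d < u.1 + u.2)%N)%:R
  end.
have [e qe|w [u w0] hw] := @poly_kernel _ U V A q q0.
  have /curveP[c [sc [i [j cn0]] ht]] := hq e qe.
  exists (fun u : U => c u.1 u.2).
    have [dij|dij] := ltnP d (i + j); first by rewrite sc ?eqxx in cn0.
    have id : (i < d.+1)%N by lia.
    have jd : (j < d.+1)%N by lia.
    by exists (Ordinal id, Ordinal jd).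
  case=> [[[l a] b]|u'] /=.
    case: (boolP (a + b < m l)%N) => h; last first.
      by rewrite big1 // => ? _; rewrite horner0 mulr0.
    rewrite -[RHS](ht l a b h) /taylor pair_big /=; apply: eq_bigr => u _ /=.
    by rewrite !hornerM !horner_exp -!polyC_natr !hornerC !mulrA.
  rewrite big1 // => u _; have [du|_] := ltnP d (u.1 + u.2).
    by rewrite sc ?mul0r.
  by rewrite andbF horner0 mulr0.
pose c i j : {poly F} := if insub i is Some i' then
  if insub j is Some j' then w (i', j') else 0 else 0.
have cE (i j : 'I_d.+1) : c i j = w (i, j) by rewrite /c !valK.
exists c; split; last 2 first.
- by exists u.1, u.2; rewrite cE -surjective_pairing.
- move=> l a b abm.
  have mN : (m l <= N)%N by rewrite /N (bigD1 l) //= leq_addr.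
  have aN : (a < N)%N by lia.
  have bN : (b < N)%N by lia.
  rewrite -[RHS](hw (inl (l, Ordinal aN, Ordinal bN))) /taylor pair_big /=.
  by rewrite abm; apply: eq_bigr => -[i j] _ /=; rewrite cE !mulrA.
move=> i j dij; rewrite /c; case: insubP => // i' _ ei; case: insubP => // j' _ ej.
move/eqP: (hw (inr (i', j'))); rewrite (bigD1 (i', j')) //= eqxx ei ej dij mulr1.
rewrite big1 ?addr0 => [/eqP //|u' /negPf /= ->]; exact: mulr0.
Qed.

(** Semicontinuity: a curve that exists for all but finitely many parameters exists at parameter
    0. *)
Lemma curve_specialize (I : finType) d (m : I -> nat)
    (p : I -> {poly F} * {poly F}) (q : {poly F}) :
    q != 0 -> (forall e, q.[e] != 0 -> curve d m (at_param p e)) ->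
  curve d m (at_param p 0).
Proof.
move=> q0 /(curve_family q0) [c [sc [i [j cn0]] ht]]; apply/curveP.
exists (fun i j => (c i j).[0]); split; last 2 first.
- by exists i, j.
- move=> l a b /ht /(congr1 (horner_eval 0)).
  by rewrite (taylor_morph (horner_eval 0)) rmorph0.
by move=> i' j' /sc ->; rewrite horner0.
Qed.

(* Unlike [effective], the points need not be distinct. *)
Definition eff (I : finType) d (m : I -> nat) := forall p, curve d m p.

End Forms.

(** * Forms and multiplicities under substitution *)

Section Cremona.
Variable F : numFieldType.
Implicit Types (G H L : F -> F -> F -> F).

Lemma isform_ext d G H : (forall x y z, G x y z = H x y z) ->
  isform d G -> isform d H.
Proof. by move=> e [c sc hc]; exists c => // x y z; rewrite -e hc. Qed.

Lemma isform0 d : isform d (fun _ _ _ : F => 0).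
Proof.
exists (fun _ _ => 0) => // x y z; rewrite /form_eval big1 // => i _.
by rewrite big1 // => j _; rewrite !mul0r.
Qed.

Lemma isformD d G H : isform d G -> isform d H ->
  isform d (fun x y z => G x y z + H x y z).
Proof.
move=> [c sc hc] [c' sc' hc']; exists (fun i j => c i j + c' i j).
  by move=> i j h; rewrite sc // sc' // addr0.
move=> x y z; rewrite hc hc' /form_eval -big_split; apply: eq_bigr => i _ /=.
by rewrite -big_split; apply: eq_bigr => j _ /=; rewrite !mulrDl.
Qed.

Lemma isform_sum (J : Type) (r : seq J) (P : pred J) d (f : J -> F -> F -> F -> F) :
  (forall j, isform d (f j)) ->
  isform d (fun x y z => \sum_(j <- r | P j) f j x y z).
Proof.
move=> h; elim: r => [|j r IH].
  by apply: isform_ext (isform0 d) => x y z; rewrite big_nil.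
case: (boolP (P j)) => Pj.
  by apply: isform_ext (isformD (h j) IH) => x y z; rewrite big_cons Pj.
by apply: isform_ext IH => x y z; rewrite big_cons (negPf Pj).
Qed.

Lemma isform_mono i j k (a : F) :
  isform (i + j + k) (fun x y z => a * x ^+ i * y ^+ j * z ^+ k).
Proof.
exists (fun i' j' => if (i' == i) && (j' == j) then a else 0).
  by move=> i' j' h; case: ifP => // /andP[/eqP e /eqP e']; lia.
move=> x y z; have li : (i < (i + j + k).+1)%N by lia.
have lj : (j < (i + j + k).+1)%N by lia.
rewrite /form_eval (bigD1 (Ordinal li)) //= (bigD1 (Ordinal lj)) //= !eqxx /=.
rewrite addKn !big1 ?addr0 // => [i' ne|j' ne].
  rewrite big1 // => j' _; move: ne; rewrite -val_eqE /= => /negPf ->.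
  by rewrite !mul0r.
by move: ne; rewrite -val_eqE /= => /negPf ->; rewrite !mul0r.
Qed.

Lemma isformM d e G H : isform d G -> isform e H ->
  isform (d + e) (fun x y z => G x y z * H x y z).
Proof.
move=> [c sc hc] [c' sc' hc'].
pose f (u : 'I_d.+1 * 'I_d.+1) (v : 'I_e.+1 * 'I_e.+1) (x y z : F) :=
  c u.1 u.2 * c' v.1 v.2 * x ^+ (u.1 + v.1) * y ^+ (u.2 + v.2)
  * z ^+ ((d - (u.1 + u.2)) + (e - (v.1 + v.2))).
have h u v : isform (d + e) (f u v).
  have [hu|hu] := ltnP d (u.1 + u.2).
    by apply: isform_ext (isform0 _) => x y z; rewrite /f sc // !mul0r.
  have [hv|hv] := ltnP e (v.1 + v.2).
    by apply: isform_ext (isform0 _) => x y z; rewrite /f sc' // mulr0 !mul0r.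
  have -> : (d + e = (u.1 + v.1) + (u.2 + v.2)
    + ((d - (u.1 + u.2)) + (e - (v.1 + v.2))))%N by lia.
  exact: isform_mono.
apply: (@isform_ext _ (fun x y z => \sum_u \sum_v f u v x y z)); last first.
  by apply: isform_sum => u; apply: isform_sum => v; apply: h.
move=> x y z; rewrite hc hc' /form_eval ![in RHS]pair_big /= big_distrlr /=.
apply: eq_bigr => u _; apply: eq_bigr => v _; rewrite /f !exprD; ring.
Qed.

Lemma isform1 : isform 0 (fun _ _ _ : F => 1).
Proof.
apply: isform_ext (isform_mono 0 0 0 1) => x y z.
by rewrite !expr0 !mulr1.
Qed.

Lemma isformX d e L : isform e L -> isform (d * e) (fun x y z => L x y z ^+ d).
Proof.
move=> hL; elim: d => [|d IH].
  by rewrite mul0n; apply: isform_ext isform1 => x y z; rewrite expr0.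
rewrite mulSn; apply: isform_ext (isformM hL IH) => x y z; by rewrite exprS.
Qed.

Lemma isform_comp d G L1 L2 L3 : isform 1 L1 -> isform 1 L2 -> isform 1 L3 ->
  isform d G -> isform d (fun x y z => G (L1 x y z) (L2 x y z) (L3 x y z)).
Proof.
move=> h1 h2 h3 [c sc hc].
pose f (i j : nat) x y z := c i j * L1 x y z ^+ i * L2 x y z ^+ j
  * L3 x y z ^+ (d - (i + j)).
have h i j : isform d (f i j).
  have [hu|hu] := ltnP d (i + j).
    by apply: isform_ext (isform0 _) => x y z; rewrite /f sc // !mul0r.
  have -> : (d = 0 + i * 1 + j * 1 + (d - (i + j)) * 1)%N by lia.
  apply: isform_ext (isformM (isformM (isformM (isform_mono 0 0 0 (c i j))
    (isformX i h1)) (isformX j h2)) (isformX (d - (i + j)) h3)).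
  by move=> x y z; rewrite /f !expr0 !mulr1.
apply: (@isform_ext _ (fun x y z => \sum_(i < d.+1) \sum_(j < d.+1) f i j x y z)).
  by move=> x y z; rewrite hc.
by apply: isform_sum => i; apply: isform_sum => j; apply: h.
Qed.

Lemma isform_linear (a b c : F) : isform 1 (fun x y z => a * x + b * y + c * z).
Proof.
apply: isform_ext (isformD (isformD (isform_mono 1 0 0 a) (isform_mono 0 1 0 b))
  (isform_mono 0 0 1 c)) => x y z.
by rewrite !expr0 !expr1 !mulr1.
Qed.

Lemma isform_scale d G s x y z : isform d G ->
  G (s * x) (s * y) (s * z) = s ^+ d * G x y z.
Proof.
case=> c sc hc; rewrite !hc /form_eval mulr_sumr; apply: eq_bigr => i _.
rewrite mulr_sumr; apply: eq_bigr => j _.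
have [h|h] := ltnP d (i + j); first by rewrite sc // !(mul0r, mulr0).
have -> : s ^+ d = s ^+ i * s ^+ j * s ^+ (d - (i + j)).
  by rewrite -!exprD subnKC.
by rewrite !exprMn; ring.
Qed.

Lemma mult_scale d G s x y z n : isform d G -> s != 0 -> mult G x y z n ->
  mult G (s * x) (s * y) (s * z) n.
Proof.
move=> fG s0 h X Y Z X0 Y0 Z0.
have [||| g hg] := h (s^-1 *: X) (s^-1 *: Y) (s^-1 *: Z).
- by rewrite hornerZ X0 mulKf.
- by rewrite hornerZ Y0 mulKf.
- by rewrite hornerZ Z0 mulKf.
exists (s ^+ d *: g) => t; rewrite hornerZ mulrCA -hg -(isform_scale _ _ _ _ fG).
by rewrite !hornerZ !mulVKf.
Qed.

Lemma mult_comp e1 e2 e3 G L1 L2 L3 x y z n :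
    isform e1 L1 -> isform e2 L2 -> isform e3 L3 ->
    mult G (L1 x y z) (L2 x y z) (L3 x y z) n ->
  mult (fun x y z => G (L1 x y z) (L2 x y z) (L3 x y z)) x y z n.
Proof.
move=> h1 h2 h3 hG X Y Z X0 Y0 Z0.
have [g1 hg1] := form_arc X Y Z h1; have [g2 hg2] := form_arc X Y Z h2.
have [g3 hg3] := form_arc X Y Z h3.
have [||| g hg] := hG g1 g2 g3; rewrite -?hg1 -?hg2 -?hg3 ?X0 ?Y0 ?Z0 //.
by exists g => t; rewrite hg1 hg2 hg3 hg.
Qed.

Lemma mult_sum (J : Type) (r : seq J) (P : pred J) x y z n
    (f : J -> F -> F -> F -> F) :
  (forall j, mult (f j) x y z n) ->
  mult (fun x y z => \sum_(j <- r | P j) f j x y z) x y z n.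
Proof.
move=> h X Y Z X0 Y0 Z0; elim: r => [|j r [g hg]].
  by exists 0 => t; rewrite big_nil horner0 mulr0.
have [g' hg'] := h j X Y Z X0 Y0 Z0; case: (boolP (P j)) => Pj.
  by exists (g' + g) => t; rewrite big_cons Pj hg hg' hornerD mulrDr.
by exists g => t; rewrite big_cons (negPf Pj) hg.
Qed.

Lemma mult_mono (a : F) i j k x y z n :
    (n <= (x == 0)%R * i + (y == 0)%R * j + (z == 0)%R * k)%N ->
  mult (fun x y z => a * x ^+ i * y ^+ j * z ^+ k) x y z n.
Proof.
(* The boolean serves as exponent: a factor X is taken out just when the coordinate vanishes at the
   point. *)
have E (u : F) (X : {poly F}) : X.[0] = u -> exists U, X = 'X^(u == 0)%R * U.
  case: eqVneq => [-> /root0_Xmul //|_ _]; exists X; by rewrite expr0 mul1r.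
move=> hn X Y Z /E[U ->] /E[V ->] /E[W ->].
set N := (_ + _)%N in hn.
exists (a *: ('X^(N - n) * (U ^+ i * V ^+ j * W ^+ k))) => t.
rewrite hornerZ !hornerM !horner_exp hornerX !exprMn -!exprM.
have -> : t ^+ n * (a * (t ^+ (N - n) * (U.[t] ^+ i * V.[t] ^+ j * W.[t] ^+ k)))
  = t ^+ N * (a * (U.[t] ^+ i * V.[t] ^+ j * W.[t] ^+ k)).
  by rewrite -{2}(subnKC hn) exprD; ring.
by rewrite /N !exprD; ring.
Qed.

(* Where the coordinates do not vanish the monomial is a unit along the arc. *)
Lemma mult_cancel e G H m1 m2 m3 x y z n : isform e H ->
    (forall x y z, H x y z * (x ^+ m1 * y ^+ m2 * z ^+ m3)
                   = G (y * z) (x * z) (x * y)) ->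
    x != 0 -> y != 0 -> z != 0 -> mult G (y * z) (x * z) (x * y) n ->
  mult H x y z n.
Proof.
move=> fH e0 x0 y0 z0 hG X Y Z X0 Y0 Z0.
have [h hh] := form_arc X Y Z fH.
have [||| g hg] := hG (Y * Z) (X * Z) (X * Y);
  rewrite ?hornerM ?X0 ?Y0 ?Z0 //.
pose M := X ^+ m1 * Y ^+ m2 * Z ^+ m3.
have eM : h * M = 'X^n * g.
  apply/eqP; rewrite -subr_eq0; apply/eqP/poly_eq0_horner => t.
  rewrite hornerD hornerN; apply/eqP; rewrite subr_eq0; apply/eqP.
  by rewrite ![in LHS]hornerM !horner_exp -hh e0 hornerM hornerXn -hg !hornerM.
have co : coprimep 'X^n M.
  apply: coprimep_expl; rewrite coprimep_sym -['X]subr0 -polyC0 coprimep_XsubC.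
  rewrite /root !hornerM !horner_exp X0 Y0 Z0.
  by rewrite !mulf_neq0 // expf_neq0.
have : 'X^n %| h * M by rewrite eM dvdp_mulIl.
rewrite Gauss_dvdpl // => /dvdpP[k ek]; exists k => t.
by rewrite hh ek hornerM hornerXn mulrC.
Qed.

Lemma form_eval_swap12 d (c : nat -> nat -> F) x y z :
  form_eval d c x y z = form_eval d (fun i j => c j i) y x z.
Proof.
rewrite /form_eval exchange_big; apply: eq_bigr => i _; apply: eq_bigr => j _.
by rewrite addnC; ring.
Qed.

Lemma form_eval_swap13 d (c : nat -> nat -> F) x y z : supported d c ->
  form_eval d c x y z =
  form_eval d (fun i j => if (i + j <= d)%N then c (d - (i + j))%N j else 0) z y x.
Proof.
move=> sc; rewrite /form_eval exchange_big [RHS]exchange_big.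
apply: eq_bigr => j _ /=; have jd : (d - j < d.+1)%N by lia.
pose f i := c i j * x ^+ i * y ^+ j * z ^+ (d - (i + j)).
have -> : \sum_(i < d.+1) f i = \sum_(i < (d - j).+1) f i.
  rewrite (big_ord_widen _ _ jd) big_mkcond [RHS]big_mkcond /=.
  apply: eq_bigr => i _; case: ltnP => // h; rewrite /f sc ?mul0r //; lia.
rewrite (reindex_inj rev_ord_inj) /=.
rewrite (big_ord_widen d.+1 (fun i => f (d - j - i)%N)) // big_mkcond /=.
apply: eq_bigr => i _.
have [h|h] := ltnP i (d - j).+1; last by case: ifP => h'; [lia|rewrite !mul0r].
have jd' := ltn_ord j.
have -> : (i + j <= d)%N by lia.
rewrite /f (_ : d - j - i = d - (i + j))%N; last by lia.
rewrite (_ : d - (d - (i + j) + j) = i)%N; last by lia.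
by ring.
Qed.
End Cremona.

(** * Quadratic Cremona maps acting on curves *)

Section CremonaEff.
Variable F : numFieldType.
Implicit Types (G H L : F -> F -> F -> F).

(** At a coordinate vertex the multiplicity bounds exponents: every monomial present has degree at
    least [n] in the other two variables. The other vertices follow by swapping coordinates. *)
Lemma mult_vertex3 d (c : nat -> nat -> F) G n i j :
    supported d c -> (forall x y z, G x y z = form_eval d c x y z) ->
  mult G 0 0 1 n -> c i j != 0 -> (n <= i + j)%N.
Proof.
move=> sc hG hm; apply: contraNT; rewrite -ltnNge => h.
by rewrite -(taylor0 i j sc); apply/eqP; apply: mult_taylor hm h.
Qed.

Lemma mult_perm13 G x y z n : mult G x y z n ->
  mult (fun x y z => G z y x) z y x n.
Proof. by move=> h X Y Z X0 Y0 Z0; apply: h. Qed.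

Lemma mult_perm12 G x y z n : mult G x y z n ->
  mult (fun x y z => G y x z) y x z n.
Proof. by move=> h X Y Z X0 Y0 Z0; apply: h. Qed.

Lemma mult_vertex1 d (c : nat -> nat -> F) G n i j :
    supported d c -> (forall x y z, G x y z = form_eval d c x y z) ->
  mult G 1 0 0 n -> c i j != 0 -> (n <= d - i)%N.
Proof.
move=> sc hG hm cij; have [h|ijd] := ltnP d (i + j).
  by rewrite sc ?eqxx in cij.
pose c' i j := if (i + j <= d)%N then c (d - (i + j))%N j else 0.
have -> : (d - i = (d - (i + j)) + j)%N by lia.
apply: (@mult_vertex3 d c' (fun x y z => G z y x)).
- by move=> k l h; rewrite /c' leqNgt h.
- by move=> x y z; rewrite hG form_eval_swap13.
- exact: mult_perm13.
have hk : (d - (i + j) + j <= d)%N by lia.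
by rewrite /c' hk (_ : d - (d - (i + j) + j) = i)%N //; lia.
Qed.

Lemma mult_vertex2 d (c : nat -> nat -> F) G n i j :
    supported d c -> (forall x y z, G x y z = form_eval d c x y z) ->
  mult G 0 1 0 n -> c i j != 0 -> (n <= d - j)%N.
Proof.
move=> sc hG hm cij.
apply: (@mult_vertex1 d (fun i j => c j i) (fun x y z => G y x z) n j i) => //.
- by move=> k l h; rewrite sc // addnC.
- by move=> x y z; rewrite hG form_eval_swap12.
exact: mult_perm12.
Qed.

(** Moving from a point of nonvanishing in the direction (1, 1, 1), the form and the three
    coordinates are nonzero polynomials in the parameter. *)
Lemma form_neq0_torus d G : isform d G -> (exists x y z, G x y z != 0) ->
  exists x y z, [/\ x != 0, y != 0, z != 0 & G x y z != 0].
Proof.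
move=> fG [x [y [z G0]]].
have [g hg] := form_arc (x%:P + 'X) (y%:P + 'X) (z%:P + 'X) fG.
have nz (u : F) : u%:P + 'X != 0.
  by rewrite addrC -size_poly_eq0 size_XaddC.
have g0 : g != 0.
  apply: contraNneq G0 => g0; have := hg 0; rewrite g0 !hornerD !hornerC hornerX.
  by rewrite !addr0 => ->.
have [e] : exists e, (g * ((x%:P + 'X) * (y%:P + 'X) * (z%:P + 'X))).[e] != 0.
  by apply/exists_nonroot; rewrite !mulf_neq0.
rewrite !hornerM -hg !mulf_eq0 !negb_or => /andP[h1 /andP[/andP[h2 h3] h4]].
by exists (x%:P + 'X).[e], (y%:P + 'X).[e], (z%:P + 'X).[e].
Qed.

(** Substituting (yz, xz, xy) turns x^i y^j z^(d-i-j) into x^(d-i) y^(d-j) z^(i+j), divisible by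
    x^m1 y^m2 z^m3 by the vertex bounds; [H] is the quotient. One nonzero coefficient already gives
    m1 + m2 + m3 <= 2d. *)
Lemma cremona_form d G m1 m2 m3 :
    isform d G -> (exists x y z, G x y z != 0) ->
    mult G 1 0 0 m1 -> mult G 0 1 0 m2 -> mult G 0 0 1 m3 ->
  (m1 + m2 + m3 <= 2 * d)%N /\ exists H,
  [/\ isform (2 * d - (m1 + m2 + m3)) H, exists x y z, H x y z != 0,
      forall x y z, H x y z * (x ^+ m1 * y ^+ m2 * z ^+ m3)
                    = G (y * z) (x * z) (x * y)
    & [/\ mult H 1 0 0 (d - m2 - m3), mult H 0 1 0 (d - m1 - m3)
        & mult H 0 0 1 (d - m1 - m2)]].
Proof.
move=> fG /(form_neq0_torus fG) [x [y [z [x0 y0 z0 G0]]]] h1 h2 h3.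
case: (fG) => c sc hc.
have cP i j : c i j != 0 ->
    [/\ m1 <= d - i, m2 <= d - j, m3 <= i + j & i + j <= d]%N.
  move=> cij; split; first exact: (mult_vertex1 sc hc h1 cij).
  - exact: (mult_vertex2 sc hc h2 cij).
  - exact: (mult_vertex3 sc hc h3 cij).
  by rewrite leqNgt; apply: contraNN cij => /sc ->.
have [i [j cij]] : exists i j, c i j != 0.
  apply: contrapT => h; case/negP: G0; rewrite hc /form_eval big1 // => i _.
  rewrite big1 // => j _; have [->|ne] := eqVneq (c i j) 0.
    by rewrite !mul0r.
  by case: h; exists i, j.
split; first by have [] := cP i j cij; lia.
pose f (i j : nat) x y z := c i j * x ^+ (d - i - m1) * y ^+ (d - j - m2)
  * z ^+ (i + j - m3).
pose H x y z := \sum_(i < d.+1) \sum_(j < d.+1) f i j x y z.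
have HE x' y' z' : H x' y' z' * (x' ^+ m1 * y' ^+ m2 * z' ^+ m3)
                    = G (y' * z') (x' * z') (x' * y').
  rewrite hc mulr_suml; apply: eq_bigr => i' _.
  rewrite mulr_suml; apply: eq_bigr => j' _; rewrite /f.
  have [->|/cP[l1 l2 l3 l4]] := eqVneq (c i' j') 0; first by rewrite !mul0r.
  rewrite !exprMn.
  transitivity (c i' j' * (x' ^+ (d - i' - m1 + m1)) * (y' ^+ (d - j' - m2 + m2))
     * z' ^+ (i' + j' - m3 + m3)); first by rewrite !exprD; ring.
  rewrite !subnK //.
  have -> : (d - i' = j' + (d - (i' + j')))%N by lia.
  have -> : (d - j' = i' + (d - (i' + j')))%N by lia.
  by rewrite !exprD; ring.
have fM (P : (F -> F -> F -> F) -> Prop) : P (fun _ _ _ => 0) ->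
    (forall i j : nat, c i j != 0 -> P (f i j)) ->
    forall i j : nat, P (f i j).
  move=> P0 h i' j'; have [e|/h //] := eqVneq (c i' j') 0.
  rewrite (_ : f i' j' = fun _ _ _ => 0) //.
  by do 3 apply: funext => ?; rewrite /f e !mul0r.
have m0 u v w n : mult (fun _ _ _ : F => 0) u v w n.
  by move=> X Y Z _ _ _; exists 0 => t; rewrite horner0 mulr0.
exists H; split=> //.
- apply: isform_sum => i'; apply: isform_sum => j'.
  apply: (fM (isform _)); first exact: isform0.
  move=> k l /cP[l1 l2 l3 l4].
  have -> : (2 * d - (m1 + m2 + m3) = (d - k - m1) + (d - l - m2) + (k + l -
    m3))%N by lia.
  exact: isform_mono.
- exists (y * z), (x * z), (x * y); apply: contraNneq G0 => H0.
  have := HE (y * z) (x * z) (x * y); rewrite H0 mul0r.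
  rewrite (_ : x * z * (x * y) = x * y * z * x); last by ring.
  rewrite (_ : y * z * (x * y) = x * y * z * y); last by ring.
  rewrite (_ : y * z * (x * z) = x * y * z * z); last by ring.
  rewrite (isform_scale _ _ _ _ fG) => /esym/eqP.
  by rewrite mulf_eq0 expf_eq0 !mulf_eq0 (negPf x0) (negPf y0) (negPf z0) andbF.
split; apply: mult_sum => i'; apply: mult_sum => j';
  apply: (fM (fun g => mult g _ _ _ _)) => // k l /cP[l1 l2 l3 l4];
  apply: mult_mono; rewrite eqxx oner_eq0; lia.
Qed.

(* The determinant of the rows (x, y, z), (b, 1), (c, 1): a multiple of the
   coordinate at a of (x, y, z) in the basis a, b, c. *)
Definition bary (R : comNzRingType) (b c : R * R) (x y z : R) :=
  (b.2 - c.2) * x + (c.1 - b.1) * y + (b.1 * c.2 - c.1 * b.2) * z.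

(* Non-vanishing puts P off the sides of the triangle A B C, and its image
   under the quadratic map off the line x + y + z = 0, which is the line at
   infinity of the source plane in [cremona_curve]. *)
Definition cremona_good (R : comNzRingType) (A B C P : R * R) :=
  let y1 := bary B C P.1 P.2 1 in let y2 := bary C A P.1 P.2 1 in
  let y3 := bary A B P.1 P.2 1 in
  y1 * y2 * y3 * (y2 * y3 + y1 * y3 + y1 * y2).

(* Truncated subtraction: a negative multiplicity imposes no condition. *)
Definition cremona_mult (I : finType) (i j k : I) d (m : I -> nat) l :=
  if l == i then (d - m j - m k)%N else if l == j then (d - m i - m k)%N
  else if l == k then (d - m i - m j)%N else m l.

(** The hypothesis supplies a curve through the images [q] of the points under the quadratic map
    based at A, B, C; its pullback without the sides of the triangle has the required multiplicities
    at [p]. *)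
Lemma cremona_curve (I : finType) (i j k : I) d (m : I -> nat) (p : I -> F * F) :
    i != j -> i != k -> j != k -> eff F d m ->
    bary (p j) (p k) (p i).1 (p i).2 1 != 0 ->
    (forall l, l != i -> l != j -> l != k ->
       cremona_good (p i) (p j) (p k) (p l) != 0) ->
  (m i + m j + m k <= 2 * d)%N /\
  curve (2 * d - (m i + m j + m k)) (cremona_mult i j k d m) p.
Proof.
move=> ij ik jk em D0 hg.
set A := p i in D0 hg *; set B := p j in D0 hg *; set C := p k in D0 hg *.
pose L1 := bary B C; pose L2 := bary C A; pose L3 := bary A B.
have f1 : isform 1 L1 by exact: isform_linear.
have f2 : isform 1 L2 by exact: isform_linear.
have f3 : isform 1 L3 by exact: isform_linear.
pose Y1 l := L1 (p l).1 (p l).2 1; pose Y2 l := L2 (p l).1 (p l).2 1.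
pose Y3 l := L3 (p l).1 (p l).2 1.
pose S l := Y2 l * Y3 l + Y1 l * Y3 l + Y1 l * Y2 l.
(* Coordinates are scaled to sum 1 and the third is dropped: the triangle goes to the coordinate
   vertices, any other point to (y2 y3 : y1 y3 : y1 y2). *)
pose q l : F * F := if l == i then (1, 0) else if l == j then (0, 1)
  else if l == k then (0, 0) else (Y2 l * Y3 l / S l, Y1 l * Y3 l / S l).
have [G' [fG' [x [y [z G'0]]] mG']] := em q.
pose sm (x y z : F) := x + y + z.
have fsm : isform 1 sm.
  by apply: isform_ext (isform_linear 1 1 1) => ? ? ?; rewrite !mul1r.
have fx : isform 1 (fun x _ _ : F => x).
  by apply: isform_ext (isform_linear 1 0 0) => ? ? ?; rewrite mul1r !mul0r !addr0.
have fy : isform 1 (fun _ y _ : F => y).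
  by apply: isform_ext (isform_linear 0 1 0) => ? ? ?;
    rewrite mul1r !mul0r addr0 add0r.
pose G x y z := G' x y (sm x y z).
have fG : isform d G by exact: isform_comp fx fy fsm fG'.
have mG u v w n : mult G' u v (u + v + w) n -> mult G u v w n.
  by move=> h; apply: mult_comp fx fy fsm h.
have G0 : exists x y z, G x y z != 0.
  by exists x, y, (z - x - y); rewrite /G /sm (_ : x + y + (z - x - y) = z) //;
    ring.
have [||| hM [H [fH H0 HE [mH1 mH2 mH3]]]] :=
  @cremona_form d G (m i) (m j) (m k) fG G0.
- by apply: mG; move: (mG' i); rewrite /q eqxx /= !addr0.
- by apply: mG; move: (mG' j); rewrite /q eq_sym (negPf ij) eqxx /= add0r addr0.
- apply: mG; move: (mG' k).
  by rewrite /q eq_sym (negPf ik) eq_sym (negPf jk) eqxx /= !add0r.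
split=> //; exists (fun x y z => H (L1 x y z) (L2 x y z) (L3 x y z)).
split; first exact: isform_comp fH.
  have [u [v [w Huvw]]] := H0; pose D := L1 A.1 A.2 1.
  (* The combination of A, B, C with weights (u, v, w) has barycentric coordinates D times (u, v,
     w), where D is the nonzero determinant. *)
  exists (u * A.1 + v * B.1 + w * C.1), (u * A.2 + v * B.2 + w * C.2), (u + v + w).
  rewrite (_ : L1 _ _ _ = D * u); last by rewrite /D /L1 /bary; ring.
  rewrite (_ : L2 _ _ _ = D * v); last by rewrite /D /L1 /L2 /bary; ring.
  rewrite (_ : L3 _ _ _ = D * w); last by rewrite /D /L1 /L3 /bary; ring.
  by rewrite (isform_scale _ _ _ _ fH) mulf_neq0 ?expf_neq0.
move=> l; apply: mult_comp f1 f2 f3 _; rewrite -/(Y1 l) -/(Y2 l) -/(Y3 l).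
have e2 : L2 B.1 B.2 1 = L1 A.1 A.2 1 by rewrite /L1 /L2 /bary; ring.
have e3 : L3 C.1 C.2 1 = L1 A.1 A.2 1 by rewrite /L1 /L3 /bary; ring.
have zA2 : L2 A.1 A.2 1 = 0 by rewrite /L2 /bary; ring.
have zA3 : L3 A.1 A.2 1 = 0 by rewrite /L3 /bary; ring.
have zB1 : L1 B.1 B.2 1 = 0 by rewrite /L1 /bary; ring.
have zB3 : L3 B.1 B.2 1 = 0 by rewrite /L3 /bary; ring.
have zC1 : L1 C.1 C.2 1 = 0 by rewrite /L1 /bary; ring.
have zC2 : L2 C.1 C.2 1 = 0 by rewrite /L2 /bary; ring.
rewrite /cremona_mult; case: eqVneq => [->|li].
  by have := mult_scale fH D0 mH1; rewrite mulr1 mulr0 /Y1 /Y2 /Y3 zA2 zA3.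
case: eqVneq => [->|lj].
  by have := mult_scale fH D0 mH2; rewrite mulr1 mulr0 /Y1 /Y2 /Y3 e2 zB1 zB3.
case: eqVneq => [->|lk].
  by have := mult_scale fH D0 mH3; rewrite mulr1 mulr0 /Y1 /Y2 /Y3 e3 zC1 zC2.
have := hg l li lj lk; rewrite /cremona_good -/(Y1 l) -/(Y2 l) -/(Y3 l) -/(S l).
rewrite !mulf_eq0 !negb_or => /andP[/andP[/andP[y1 y2] y3] S0].
apply: mult_cancel fH HE y1 y2 y3 _; apply: mG; rewrite -/(S l).
have := mult_scale fG' S0 (mG' l).
rewrite /q (negPf li) (negPf lj) (negPf lk) /= mulr1.
by rewrite !(mulrC (S l)) !divfK.
Qed.

Lemma bary_morph (R S : comNzRingType) (f : {rmorphism R -> S}) b c x y z :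
  f (bary b c x y z) = bary (f b.1, f b.2) (f c.1, f c.2) (f x) (f y) (f z).
Proof. by rewrite /bary !rmorphD !rmorphM !rmorphB !rmorphM. Qed.

Lemma cremona_good_morph (R S : comNzRingType) (f : {rmorphism R -> S}) A B C P :
  f (cremona_good A B C P) = cremona_good (f A.1, f A.2) (f B.1, f B.2)
    (f C.1, f C.2) (f P.1, f P.2).
Proof.
have e b c : bary (f b.1, f b.2) (f c.1, f c.2) (f P.1) (f P.2) 1
  = f (bary b c P.1 P.2 1) by rewrite bary_morph rmorph1.
rewrite /cremona_good /= !e.
move: (bary B C _ _ _) (bary C A _ _ _) (bary A B _ _ _) => y1 y2 y3.
by rewrite !(rmorphM, rmorphD).
Qed.

(** An arbitrary configuration lies on a line of configurations through a good one; the curves found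
    at good parameters specialise to it. *)
Lemma eff_cremona (I : finType) (i j k : I) d (m : I -> nat) :
    i != j -> i != k -> j != k -> eff F d m ->
  (m i + m j + m k <= 2 * d)%N /\
  eff F (2 * d - (m i + m j + m k)) (cremona_mult i j k d m).
Proof.
move=> ij ik jk em.
(* A unit triangle with all other points at (1, 1): every nondegeneracy expression evaluates to
   1. *)
pose w l : F * F := if l == i then (0, 0) else if l == j then (1, 0)
  else if l == k then (0, 1) else (1, 1).
have wi : w i = (0, 0) by rewrite /w eqxx.
have wj : w j = (1, 0) by rewrite /w eq_sym (negPf ij) eqxx.
have wk : w k = (0, 1) by rewrite /w eq_sym (negPf ik) eq_sym (negPf jk) eqxx.
have w1 : bary (w j) (w k) (w i).1 (w i).2 1 != 0.
  rewrite wi wj wk /bary /= (_ : _ + _ = 1) ?oner_neq0 //; ring.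
have w2 l : l != i -> l != j -> l != k -> cremona_good (w i) (w j) (w k) (w l) != 0.
  move=> li lj lk; rewrite wi wj wk /w (negPf li) (negPf lj) (negPf lk).
  by rewrite /cremona_good /bary /= (_ : _ * _ = 1) ?oner_neq0 //; ring.
split; first by have [] := cremona_curve ij ik jk em w1 w2.
move=> p; pose P l : {poly F} * {poly F} :=
  ((p l).1%:P + ((w l).1 - (p l).1) *: 'X, (p l).2%:P + ((w l).2 - (p l).2) *: 'X).
pose q := bary (P j) (P k) (P i).1 (P i).2 1 *
  \prod_(l | [&& l != i, l != j & l != k]) cremona_good (P i) (P j) (P k) (P l).
have P0 : at_param P 0 = p.
  apply: funext => l; rewrite /at_param !hornerD !hornerC !hornerZ !hornerX.
  by rewrite !mulr0 !addr0 -surjective_pairing.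
have P1 : at_param P 1 = w.
  apply: funext => l; rewrite /at_param !hornerD !hornerC !hornerZ !hornerX.
  by rewrite !mulr1 !subrKC -surjective_pairing.
have qE e : q.[e] = bary (at_param P e j) (at_param P e k) (at_param P e i).1
    (at_param P e i).2 1 * \prod_(l | [&& l != i, l != j & l != k])
    cremona_good (at_param P e i) (at_param P e j) (at_param P e k) (at_param P
      e l).
  rewrite hornerM horner_prod; congr (_ * _).
    by rewrite -/(horner_eval e _) bary_morph rmorph1.
  by apply: eq_bigr => l _; rewrite -/(horner_eval e _) cremona_good_morph.
rewrite -P0; apply: (@curve_specialize _ _ _ _ P q) => [|e].
  apply/negP => /eqP q0; have := qE 1; rewrite q0 horner0 P1 => /esym/eqP.
  rewrite mulf_eq0 (negPf w1) /=; apply/negP/prodf_neq0 => l /and3P[]; exact: w2.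
rewrite qE mulf_eq0 negb_or => /andP[h1 /prodf_neq0 h2].
have [|] := cremona_curve ij ik jk em h1 _; last by [].
by move=> l li lj lk; apply: h2; rewrite li lj lk.
Qed.

End CremonaEff.

(** * Collision of k^2 points in a shrinking grid *)

Section Collision.
Variable F : numFieldType.
Implicit Types (P Q : {poly {poly F}}).

Lemma coef_XaddC_exp (R : comNzRingType) (c : R) i a :
  (('X + c%:P) ^+ i)`_a = 'C(i, a)%:R * c ^+ (i - a).
Proof.
rewrite addrC exprDn coef_sum.
under eq_bigr => l _ do rewrite -polyC_exp coefMn coefCM coefXn.
have [ia|ai] := ltnP i a.
  rewrite bin_small // mul0r big1 // => l _.
  rewrite (_ : (a == l :> nat) = false) ?mulr0 ?mul0rn //.
  by apply/eqP; have := ltn_ord l; lia.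
have ai' : (a < i.+1)%N by [].
rewrite (bigD1 (Ordinal ai')) //= eqxx mulr1 mulr_natl big1 ?addr0 // => l.
by rewrite -val_eqE /= eq_sym => /negPf ->; rewrite mulr0 mul0rn.
Qed.

(** The outer variable is the first coordinate, the inner one the second, so that a line x =
    constant is a monic linear factor. *)
Definition taylor_poly P (x y : F) a b :=
  ((P \Po ('X + (x%:P)%:P))`_a \Po ('X + y%:P))`_b.

Definition plane_poly D (c : nat -> nat -> F) : {poly {poly F}} :=
  \poly_(i < D.+1) \poly_(j < D.+1) c i j.

Lemma taylor_plane_poly D c x y a b :
  taylor_poly (plane_poly D c) x y a b = taylor D c (x, y) a b.
Proof.
rewrite /taylor_poly /plane_poly poly_def raddf_sum coef_sum /=.
rewrite raddf_sum coef_sum /taylor; apply: eq_bigr => i _ /=.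
rewrite comp_polyZ comp_Xn_poly coefZ coef_XaddC_exp -polyC_exp -polyC_natr.
rewrite !comp_polyM !comp_polyC poly_def raddf_sum mulr_suml coef_sum /=.
apply: eq_bigr => j _; rewrite comp_polyZ comp_Xn_poly mulrA !coefMC coefZ.
by rewrite coef_XaddC_exp; ring.
Qed.

Lemma order_dvdp (R : {poly F}) y n :
  (forall b, (b < n)%N -> (R \Po ('X + y%:P))`_b = 0) -> ('X - y%:P) ^+ n %| R.
Proof.
move=> h; set Q := R \Po ('X + y%:P) in h.
have -> : R = Q \Po ('X - y%:P) by rewrite comp_polyXaddC_K.
have -> : ('X - y%:P) ^+ n = 'X^n \Po ('X - y%:P) by rewrite comp_Xn_poly.
apply: dvdp_comp_poly; rewrite -(poly_take_drop n Q).
have -> : take_poly n Q = 0.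
  by apply/polyP => b; rewrite coef_take_poly coef0; case: ifP => // /h.
by rewrite add0r dvdp_mull.
Qed.

Lemma prod_dvdp (J : eqType) (r : seq J) (f : J -> {poly F}) R :
    uniq r -> (forall i j, i != j -> coprimep (f i) (f j)) ->
    (forall j, f j %| R) -> \prod_(j <- r) f j %| R.
Proof.
move=> ur co h; elim: r ur => [|j r IH] /=; first by rewrite big_nil dvd1p.
case/andP=> jr ur; rewrite big_cons Gauss_dvdp ?h ?IH //.
rewrite big_seq; apply: (big_ind (coprimep (f j))) => [|x y hx hy|i ir].
- exact: coprimep1.
- by rewrite coprimepMr hx.
by apply: co; apply: contraNneq jr => ->.
Qed.

(** Otherwise the product of the coprime ('X - j)^(n j), of degree the sum of the [n j], divides R,
    whose degree is smaller. *)
Lemma orders_size (k : nat) (R : {poly F}) (n : 'I_k -> nat) :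
    (forall j b, (b < n j)%N -> (R \Po ('X + (j%:R)%:P))`_b = 0) ->
  (size R <= \sum_j n j)%N -> R = 0.
Proof.
move=> h sz; apply/eqP; apply: contraTT sz => R0; rewrite -ltnNge.
have : \prod_(j <- index_enum 'I_k) ('X - ((j%:R : F))%:P) ^+ n j %| R.
  apply: prod_dvdp; first exact: index_enum_uniq.
    move=> i j ij; apply/coprimep_expl/coprimep_expr; rewrite coprimep_XsubC.
    by rewrite root_XsubC eqr_nat eq_sym.
  by move=> j; apply: order_dvdp => b; apply: h.
move/dvdp_leq => /(_ R0); rewrite size_prod; last first.
  by move=> j _; rewrite expf_neq0 // polyXsubC_eq0.
under eq_bigr => j _ do rewrite size_exp_XsubC -addn1.
rewrite big_split /= sum1_card.
by rewrite -addSn addnK.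
Qed.

(** Leibniz rule for removing a line: orders on the line shift by one, elsewhere the factor x' - x
    is invertible. *)
Lemma taylor_poly_XsubC P (x x' y : F) a b :
  taylor_poly (P * ('X - (x%:P)%:P)) x' y a b =
  (if a is a'.+1 then taylor_poly P x' y a' b else 0)
  + (x' - x) * taylor_poly P x' y a b.
Proof.
rewrite /taylor_poly comp_polyM comp_polyB comp_polyX comp_polyC.
set Q := P \Po _.
have -> : 'X + x'%:P%:P - x%:P%:P = 'X + (x' - x)%:P%:P :> {poly {poly F}}.
  by rewrite !polyCB addrA.
rewrite mulrDr coefD coefMX coefMC comp_polyD coefD comp_polyM comp_polyC.
rewrite coefMC [_ * (x' - x)]mulrC; congr (_ + _).
by case: a => //=; rewrite comp_poly0 coef0.
Qed.

(* A row of the grid carrying more conditions than the degree is a component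
   of the curve; removing it costs k in both k * delta and the sum. *)
Lemma grid_poly k delta P (n : 'I_k -> 'I_k -> nat) : P != 0 ->
    (forall i j, P`_i`_j != 0 -> (i + j <= delta)%N) ->
    (forall i j a b, (a + b < n i j)%N -> taylor_poly P i%:R j%:R a b = 0) ->
  (\sum_i \sum_j n i j <= k * delta)%N.
Proof.
elim/ltn_ind: delta P n => delta IH P n P0 hd ht.
case: (boolP [exists i, (delta < \sum_j n i j)%N]) => [/existsP[i hi]|]; last first.
  rewrite negb_exists => /forallP h.
  rewrite -[X in (_ <= X * _)%N](card_ord k) -sum_nat_const; apply: leq_sum => i _.
  by rewrite leqNgt; apply: h.
pose x : F := i%:R.
(* Restricted to the line x = i, P has degree at most [delta], less than the total order prescribed
   there, so it vanishes on the line. *)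
have /factor_theorem[P1 eP] : root P x%:P.
  apply/rootP; apply: (@orders_size k _ (n i)) => [j b bn|].
    have := ht i j 0 b; rewrite add0n => /(_ bn) => h; rewrite -[RHS]h.
    rewrite /taylor_poly; congr ((_ \Po _)`_b).
    by rewrite -horner_coef0 horner_comp hornerD hornerX hornerC add0r.
  apply: leq_trans hi; rewrite horner_coef; apply/leq_sizeP => j dj.
  rewrite coef_sum big1 // => l _; rewrite -polyC_exp coefMC.
  have [->|/hd] := eqVneq (P`_l)`_j 0; first by rewrite mul0r.
  by lia.
(* The degree bound on the quotient descends from the top power of the outer variable through P1_l =
   P_(l+1) + x P1_(l+1). *)
have P1d l j : P1`_l`_j != 0 -> (l + j < delta)%N.
  have [N] := ubnP (size P1 - l); elim: N l j => // N IHN l j hN.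
  have [lP|lP] := leqP (size P1) l; first by rewrite (nth_default 0 lP) coef0 eqxx.
  have e : P1`_l = P`_l.+1 + x%:P * P1`_l.+1.
    by rewrite eP mulrBr coefB coefMX coefMC /= mulrC subrK.
  rewrite e coefD coefCM; have [->|/hd] := eqVneq (P`_l.+1)`_j 0; last by lia.
  have [->|/IHN] := eqVneq (P1`_l.+1)`_j 0; first by rewrite mulr0 addr0 eqxx.
  by move=> h _; have := h _; lia.
have P10 : P1 != 0 by apply: contraNneq P0 => h; rewrite eP h mul0r.
have [l [j P1lj]] : exists l j, P1`_l`_j != 0.
  exists (size P1).-1, (size P1`_(size P1).-1).-1.
  by rewrite -!lead_coefE !lead_coef_eq0.
have dpos := P1d l j P1lj.
pose n' i' j := if i' == i then (n i' j).-1 else n i' j.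
have ht1 i' j' a b : (a + b < n' i' j')%N -> taylor_poly P1 i'%:R j'%:R a b = 0.
  rewrite /n'; have [->|ne] := eqVneq i' i.
    move=> abn; have : (a.+1 + b < n i j')%N by lia.
    by move/ht; rewrite eP taylor_poly_XsubC subrr mul0r addr0.
  elim: a => [|a IHa] abn; have := ht i' j' _ _ abn;
    rewrite eP taylor_poly_XsubC ?add0r ?IHa ?add0r; try by lia.
    move/eqP; rewrite mulf_eq0 subr_eq0 eqr_nat => /orP[|/eqP //].
    by move=> /eqP/val_inj/eqP; rewrite (negPf ne).
  move/eqP; rewrite mulf_eq0 subr_eq0 eqr_nat => /orP[|/eqP //].
  by move=> /eqP/val_inj/eqP; rewrite (negPf ne).
have := IH delta.-1 _ P1 n' P10 _ ht1.
have -> : (delta.-1 < delta)%N by lia.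
move=> /(_ isT) H; have {}H : (\sum_i \sum_j n' i j <= k * delta.-1)%N.
  by apply: H => l' j' /P1d; lia.
have le : (\sum_i \sum_j n i j <= \sum_i \sum_j n' i j + k)%N.
  rewrite (bigD1 i) //= [X in (_ <= X + _)%N](bigD1 i) //= -addnA [(_ +
    k)%N]addnC addnA.
  apply: leq_add; last by apply: leq_sum => i' /negPf ne; rewrite /n' ne.
  rewrite /n' eqxx -[X in (_ <= _ + X)%N](card_ord k) -sum1_card -big_split /=.
  by apply: leq_sum => j' _; lia.
apply: (leq_trans le); apply: leq_trans (leq_add H (leqnn k)) _.
by rewrite -mulnSr prednK //; lia.
Qed.

Lemma plane_poly_coef D c i j : supported D c -> (plane_poly D c)`_i`_j = c i j.
Proof.
move=> sc; rewrite /plane_poly coef_poly; case: ltnP => h; last first.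
  by rewrite coef0 sc //; lia.
by rewrite coef_poly; case: ltnP => // h'; rewrite sc //; lia.
Qed.

(* T i j = c i j X^(i+j) / X^r is the family rescaled around the limit point,
   with r as large as possible; its value t at 0 is a nonzero polynomial of
   degree at most r with the prescribed multiplicities on the grid, while the
   limit curve has multiplicity at least r. *)
Lemma eff_collide (I : finType) k d (m : I -> nat) (n : 'I_k -> 'I_k -> nat) mu :
    (k * mu < \sum_i \sum_j n i j + k)%N ->
    eff F d (fun x : I + 'I_k * 'I_k =>
      match x with inl l => m l | inr g => n g.1 g.2 end) ->
  eff F d (fun x : option I => if x is Some l then m l else mu).
Proof.
move=> hmu em p; pose p0 := p None.
suff [G [fG [x [y [z G0]]] mG]] : curve d
    (fun x : option I => if x is Some l then m l else mu)
    (fun l => ((p l).1 - p0.1, (p l).2 - p0.2)).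
  pose L1 (x y z : F) := 1 * x + 0 * y + (- p0.1) * z.
  pose L2 (x y z : F) := 0 * x + 1 * y + (- p0.2) * z.
  pose L3 (x y z : F) := 0 * x + 0 * y + 1 * z.
  have f1 : isform 1 L1 by exact: isform_linear.
  have f2 : isform 1 L2 by exact: isform_linear.
  have f3 : isform 1 L3 by exact: isform_linear.
  exists (fun x y z => G (L1 x y z) (L2 x y z) (L3 x y z)); split.
  - exact: isform_comp fG.
  - exists (x + p0.1 * z), (y + p0.2 * z), z; rewrite /L1 /L2 /L3.
    rewrite (_ : _ + _ + - p0.1 * z = x); last by ring.
    rewrite (_ : _ + _ + - p0.2 * z = y); last by ring.
    by rewrite (_ : _ + _ + 1 * z = z) //; ring.
  move=> l; apply: mult_comp f1 f2 f3 _.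
  rewrite /L1 /L2 /L3 !mul1r !mul0r !mulr1 !addr0 !add0r; exact: mG.
(* The parameter is the scale of the grid, which shrinks to the origin at 0. *)
pose P (x : I + 'I_k * 'I_k) : {poly F} * {poly F} := match x with
  | inl l => (((p (Some l)).1 - p0.1)%:P, ((p (Some l)).2 - p0.2)%:P)
  | inr g => ((g.1%:R)%:P * 'X, (g.2%:R)%:P * 'X) end.
have [c [sc [i0 [j0 c0]] ht]] :=
  curve_family (oner_neq0 _) (fun e _ => em (at_param P e)).
pose U := ('I_d.+1 * 'I_d.+1)%type.
have cU : exists u : U, (c u.1 u.2).[0] != 0.
  have [h|h] := ltnP d (i0 + j0); first by rewrite sc ?horner0 ?eqxx in c0.
  have hi : (i0 < d.+1)%N by lia.
  have hj : (j0 < d.+1)%N by lia.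
  by exists (Ordinal hi, Ordinal hj).
have [|r [S [hS [u S0]]]] := @extract_Xn F U (fun u => c u.1 u.2 * 'X^(u.1 + u.2)).
  have [u cu] := cU; exists u; rewrite mulf_neq0 ?expf_neq0 ?polyX_eq0 //.
  by apply: contraNneq cu => ->; rewrite horner0.
pose T i j : {poly F} := if insub i is Some i' then
  if insub j is Some j' then S (i', j') else 0 else 0.
have TE i j : 'X^r * T i j = c i j * 'X^(i + j).
  rewrite /T; case: insubP => [i' _ ei|]; last first.
    by move=> h; rewrite sc ?mul0r ?mulr0 //; lia.
  case: insubP => [j' _ ej|]; last by move=> h; rewrite sc ?mul0r ?mulr0 //; lia.
  by rewrite -hS /= ei ej.
have X0 (a : nat) : 'X^a != 0 :> {poly F} by rewrite expf_neq0 ?polyX_eq0.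
have sT : supported d T.
  move=> i j /sc h; have := TE i j; rewrite h mul0r => /eqP.
  by rewrite mulf_eq0 (negPf (X0 r)) => /eqP.
pose t i j := (T i j).[0].
have st : supported d t by move=> i j /sT h; rewrite /t h horner0.
have tr i j : t i j != 0 -> (i + j <= r)%N.
  rewrite leqNgt; apply: contraNN => h; have := TE i j.
  rewrite -(subnKC (ltnW h)) exprD mulrCA => /(mulfI (X0 r)).
  rewrite /t => ->; rewrite hornerM hornerXn expr0n subn_eq0 leqNgt h mulr0.
  exact: eqxx.
have c0r a b : (a + b < r)%N -> (c a b).[0] = 0.
  move=> h; have := TE a b.
  rewrite -{1}(subnKC (ltnW h)) exprD mulrC [c _ _ * _]mulrC mulrCA.
  move=> /(mulfI (X0 _)) <-.
  by rewrite hornerM hornerXn expr0n subn_eq0 leqNgt h mulr0.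
have tT g a b : (a + b < n g.1 g.2)%N -> taylor d t (g.1%:R, g.2%:R) a b = 0.
  move=> h; have := ht (inr g) a b h.
  have E : 'X^r * taylor d T ((g.1%:R)%:P, (g.2%:R)%:P) a b
      = 'X^(a + b) * taylor d c ((g.1%:R)%:P * 'X, (g.2%:R)%:P * 'X) a b.
    rewrite /taylor !mulr_sumr; apply: eq_bigr => i _; rewrite !mulr_sumr.
    apply: eq_bigr => j _ /=.
    have [ia|ai] := ltnP i a; first by rewrite bin_small // !(mulr0, mul0r).
    have [jb|bj] := ltnP j b; first by rewrite (@bin_small j) // !(mulr0, mul0r).
    rewrite !exprMn; transitivity ('X^r * T i j * 'C(i, a)%:R * 'C(j, b)%:R *
      (g.1%:R)%:P ^+ (i - a) * (g.2%:R)%:P ^+ (j - b)); first by rewrite !mulrA.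
    rewrite TE (_ : (i + j = a + b + (i - a) + (j - b))%N); last by lia.
    by rewrite !exprD; ring.
  move=> h'; move: E; rewrite h' mulr0 => /eqP.
  rewrite mulf_eq0 (negPf (X0 r)) /= => /eqP /(congr1 (horner_eval 0)).
  by rewrite (taylor_morph (horner_eval 0)) rmorph0 /= /horner_eval !hornerC.
have hr : (\sum_i \sum_j n i j <= k * r)%N.
  apply: (@grid_poly k r (plane_poly d t)).
  - apply: contraNneq S0 => h; have := plane_poly_coef u.1 u.2 st.
    by rewrite h !coef0 /t /T !valK -surjective_pairing => <-.
  - by move=> i j; rewrite plane_poly_coef //; exact: tr.
  by move=> i j a b h; rewrite taylor_plane_poly; apply: (tT (i, j)).
(* From k mu < sum + k <= k r + k. *)
have mur : (mu <= r)%N by nia.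
apply/curveP; exists (fun i j => (c i j).[0]); split.
- by move=> i j /sc ->; rewrite horner0.
- by exists i0, j0.
case=> [l|] a b h.
  have := ht (inl l) a b h => /(congr1 (horner_eval 0)).
  by rewrite (taylor_morph (horner_eval 0)) rmorph0 /= /horner_eval !hornerC.
rewrite /= !subrr taylor0; last by move=> i j /sc ->; rewrite horner0.
by apply: c0r; apply: leq_trans h mur.
Qed.

End Collision.

(** * Nef vectors and the operations preserving them *)

Section Nef.
Variables (F : numFieldType) (R : realFieldType).

Definition nef (I : finType) (v0 : R) (v : I -> R) :=
  forall d m, eff F d m -> \sum_l v l * (m l)%:R <= v0 * d%:R.

Lemma curve_restrict (I J : Type) (f : I -> J) d (m : J -> nat) (p : J -> F * F) :
  curve d m p -> curve d (m \o f) (p \o f).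
Proof. by move=> [G [fG G0 mG]]; exists G; split=> // l; apply: mG. Qed.

Lemma sum_inj (I J : finType) (f : I -> J) (h : J -> R) : injective f ->
    (forall j, (forall i, f i != j) -> h j = 0) ->
  \sum_j h j = \sum_i h (f i).
Proof.
move=> fi h0; rewrite (bigID (mem (codom f))) /= [X in _ + X]big1 ?addr0;
  last first.
  by move=> j /codomP hj; apply: h0 => i; apply/eqP => e; apply: hj; exists i.
transitivity (\sum_(j in f @: [set: I]) h j).
  by apply: eq_bigl => j; apply/codomP/imsetP => [[i ->]|[i _ ->]]; exists i.
rewrite big_imset /=; last by move=> x y _ _; apply: fi.
by apply: eq_bigl => i; rewrite inE.
Qed.

Lemma nef_inj (I J : finType) (f : I -> J) v0 (v : I -> R) (w : J -> R) :
    injective f -> (forall i, w (f i) = v i) ->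
    (forall j, (forall i, f i != j) -> w j = 0) ->
  nef v0 v -> nef v0 w.
Proof.
move=> fi wf w0 nv d m em.
have -> : \sum_j w j * (m j)%:R = \sum_i v i * (m (f i))%:R.
  rewrite (sum_inj fi); last by move=> j /w0 ->; rewrite mul0r.
  by apply: eq_bigr => i _; rewrite wf.
apply: (nv d (m \o f)) => p.
(* Points outside the image are put at (0, 0); [eff] allows coincidences. *)
pose q j := if [pick i | f i == j] is Some i then p i else (0, 0).
have -> : p = q \o f.
  apply: funext => i; rewrite /q /=; case: pickP => [i' /eqP/fi -> //|].
  by move=> /(_ i); rewrite eqxx.
exact: curve_restrict.
Qed.

(** The multiplicities after reflection in the root H - E_i - E_j - E_k. *)
Definition cremona_vec (I : finType) (i j k : I) (v0 : R) (v : I -> R) l :=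
  v l + (if l \in [:: i; j; k] then v0 - (v i + v j + v k) else 0).

Lemma sum_triple (I : finType) (i j k : I) (g : I -> R) :
  i != j -> i != k -> j != k ->
  \sum_l (if l \in [:: i; j; k] then g l else 0) = g i + g j + g k.
Proof.
move=> ij ik jk; rewrite -big_mkcond /= -big_uniq /=; last first.
  by rewrite !inE negb_or ij ik jk.
by rewrite !big_cons big_nil addr0 addrA.
Qed.

(** The reflection is self-adjoint for the intersection form. Truncation in [cremona_mult] can only
    raise multiplicities, and [v] is non-negative at the three points. *)
Lemma cremona_pairing (I : finType) (i j k : I) v0 (v : I -> R) d (m : I -> nat) :
    i != j -> i != k -> j != k -> 0 <= v i -> 0 <= v j -> 0 <= v k ->
    (m i + m j + m k <= 2 * d)%N ->
    \sum_l v l * (cremona_mult i j k d m l)%:R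
      <= v0 * (2 * d - (m i + m j + m k))%N%:R ->
  \sum_l cremona_vec i j k v0 v l * (m l)%:R
    <= (v0 + (v0 - (v i + v j + v k))) * d%:R.
Proof.
move=> ij ik jk vi vj vk hM h; set t := v0 - _.
have -> : \sum_l cremona_vec i j k v0 v l * (m l)%:R =
    \sum_l v l * (m l)%:R + t * ((m i)%:R + (m j)%:R + (m k)%:R).
  rewrite !mulrDr -(@sum_triple _ i j k (fun l => t * (m l)%:R)) //.
  rewrite -big_split; apply: eq_bigr => l _; rewrite /cremona_vec mulrDl.
  by case: ifP => _; rewrite ?mul0r.
pose D : R := d%:R - (m i)%:R - (m j)%:R - (m k)%:R.
have tr (b c : nat) : d%:R - b%:R - c%:R <= (d - b - c)%N%:R :> R.
  have [h'|h'] := leqP (b + c) d; first by rewrite !natrB ?addrA //; lia.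
  rewrite -subnDA (_ : (d - (b + c) = 0)%N); last by lia.
  by rewrite -addrA -opprD -natrD subr_le0 ler_nat ltnW.
have le : \sum_l v l * (m l)%:R + (v i + v j + v k) * D
    <= \sum_l v l * (cremona_mult i j k d m l)%:R.
  rewrite !mulrDl -(@sum_triple _ i j k (fun l => v l * D)) // -big_split /=.
  apply: ler_sum => l _; rewrite /cremona_mult !inE.
  case: eqVneq => [->|li].
    by rewrite /= -mulrDr ler_wpM2l // (le_trans _ (tr _ _)) // /D; lra.
  case: eqVneq => [->|lj].
    by rewrite /= -mulrDr ler_wpM2l // (le_trans _ (tr _ _)) // /D; lra.
  case: eqVneq => [->|lk].
    by rewrite /= -mulrDr ler_wpM2l // (le_trans _ (tr _ _)) // /D; lra.
  by rewrite addr0.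
have := le_trans le h; rewrite natrB // natrM !natrD /D /t.
move: (\sum_l _) (v i) (v j) (v k) (d%:R) (m i)%:R (m j)%:R (m k)%:R => *; nra.
Qed.

Lemma nef_cremona (I : finType) (i j k : I) v0 (v : I -> R) :
    i != j -> i != k -> j != k -> 0 <= v i -> 0 <= v j -> 0 <= v k ->
  nef v0 v -> nef (v0 + (v0 - (v i + v j + v k))) (cremona_vec i j k v0 v).
Proof.
move=> ij ik jk vi vj vk nv d m em.
have [hM em'] := eff_cremona ij ik jk em.
by apply: cremona_pairing => //; apply: nv.
Qed.

Lemma sum_option (I : finType) (g : option I -> R) :
  \sum_x g x = g None + \sum_l g (Some l).
Proof.
rewrite (bigD1 None) //= (@reindex_omap _ _ _ _ _ Some id) /=; last by case.
by congr (_ + _); apply: eq_bigl => l; rewrite eqxx.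
Qed.

Lemma nef_collide (I : finType) k v0 (v : option I -> R) : (0 < k)%N ->
    0 <= v None -> nef v0 v ->
  nef v0 (fun x : I + 'I_k * 'I_k =>
    if x is inl l then v (Some l) else v None / k%:R).
Proof.
move=> k0 vN nv d m em; pose n i j := m (inr (i, j)).
(* [mu] is N / k rounded up, the multiplicity forced at the limit point. *)
pose N := (\sum_i \sum_j n i j)%N; pose mu := ((N + k.-1) %/ k)%N.
have mu1 : (k * mu < N + k)%N.
  by have := leq_divM (N + k.-1) k; rewrite -/mu; lia.
have mu2 : (N <= k * mu)%N.
  by have := ltn_ceil (N + k.-1) k0; rewrite -/mu; lia.
have em' : eff F d (fun x : I + 'I_k * 'I_k =>
      match x with inl l => m (inl l) | inr g => n g.1 g.2 end).
  rewrite (_ : (fun _ => _) = m) //; apply: funext => -[//|[i j]]; by [].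
have := nv _ _ (eff_collide mu1 em').
rewrite sum_option /= => h; apply: le_trans h; rewrite big_sumType /= addrC.
apply: lerD => //; rewrite -mulr_sumr -natr_sum -mulrA ler_wpM2l //.
rewrite mulrC ler_pdivrMr ?ltr0n // mulrC -natrM ler_nat.
rewrite (eq_bigr (fun g : 'I_k * 'I_k => n g.1 g.2)); last by case.
by rewrite -(pair_bigA _ n).
Qed.

(** By Lagrange's identity the double sum of squares is twice the difference of the two sides. *)
Lemma cauchy_schwarz (I : finType) (a b : I -> R) :
  (\sum_i a i * b i) ^+ 2 <= (\sum_i a i ^+ 2) * (\sum_i b i ^+ 2).
Proof.
have : 0 <= \sum_i \sum_j (a i * b j - a j * b i) ^+ 2.
  by apply: sumr_ge0 => i _; apply: sumr_ge0 => j _; rewrite sqr_ge0.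
have -> : \sum_i \sum_j (a i * b j - a j * b i) ^+ 2 =
    \sum_i \sum_j a i ^+ 2 * b j ^+ 2 + \sum_i \sum_j b i ^+ 2 * a j ^+ 2
    - 2 * \sum_i \sum_j (a i * b i) * (a j * b j).
  rewrite mulr_sumr -big_split /= -sumrB; apply: eq_bigr => i _ /=.
  by rewrite mulr_sumr -big_split -sumrB /=; apply: eq_bigr => j _; ring.
rewrite -!big_distrlr /=; set A := \sum_i a i ^+ 2; set B := \sum_i b i ^+ 2.
set C := \sum_i _; nra.
Qed.

Lemma exists_notin (I : finType) (s : seq I) :
  (size s < #|I|)%N -> exists l, l \notin s.
Proof.
move=> h; apply/existsP; apply: contraLR h;
  rewrite negb_exists -leqNgt => /forallP h.
rewrite cardE; apply: uniq_leq_size (enum_uniq I) _ => l _.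
by move: (h l); rewrite negbK.
Qed.

Lemma exists_max (I : finType) (u : I -> nat) (s : seq I) :
    (size s < #|I|)%N ->
  exists2 a, a \notin s & forall l, l \notin s -> (u l <= u a)%N.
Proof.
move=> /exists_notin[x xs].
by case: (@arg_maxnP I x (fun l => l \notin s) u xs) => a as_ h; exists a.
Qed.

(** Let a >= b >= c be the three largest values. One value is 0, so the sum is at most a^2 + b^2 +
    7c^2 <= (a + b + c)^2 <= d^2. *)
Lemma square_bound10 (I : finType) (u : I -> nat) d l0 : #|I| = 10%N ->
    u l0 = 0%N ->
    (forall i j k, i != j -> i != k -> j != k -> u i + u j + u k <= d)%N ->
  (\sum_l u l ^ 2 <= d ^ 2)%N.
Proof.
move=> I10 u0 h.
have [|a _ ha] := @exists_max I u [::]; first by rewrite I10.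
have [|b bs hb] := @exists_max I u [:: a]; first by rewrite I10.
have [|c cs hc] := @exists_max I u [:: a; b]; first by rewrite I10.
move: bs cs; rewrite !inE negb_or => ba /andP[ca cb].
have hd : (u a + u b + u c <= d)%N.
  by apply: h; [rewrite eq_sym|rewrite eq_sym|rewrite eq_sym].
have ab : (u b <= u a)%N by apply: ha.
have bc : (u c <= u b)%N by apply: hb; rewrite inE.
rewrite (bigD1 a) //= (bigD1 b) //=.
suff le : (\sum_(i | (i != a) && (i != b)) u i ^ 2 <= 7 * u c ^ 2)%N by nia.
have [uc0|ucp] := posnP (u c).
  rewrite big1 // => i /andP[ia ib]; have := hc i.
  by rewrite !inE negb_or ia ib uc0 => /(_ isT); rewrite leqn0 => /eqP ->.
have l0a : l0 != a by apply: contraTneq ucp => e; rewrite -e u0 in ab; lia.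
have l0b : l0 != b by apply: contraTneq ucp => e; rewrite -e u0 in bc; lia.
rewrite (bigD1 l0) ?l0a //= u0 /= add0n.
have -> : (7 * u c ^ 2 = \sum_(i | (i != a) && (i != b) && (i != l0)) u c ^ 2)%N.
  rewrite sum_nat_const; congr (_ * _)%N; apply/eqP.
  rewrite -(eqn_add2l 3) (_ : 3 + 7 = #|I|)%N // -[X in X == _]sum1_card (bigD1
    a) //= (bigD1 b) //=.
  by rewrite (bigD1 l0) ?l0a //= sum1_card !addnA.
apply: leq_sum => i /andP[/andP[ia ib] _]; rewrite leq_exp2r //.
by apply: hc; rewrite !inE negb_or ia.
Qed.

(** Cauchy-Schwarz over the other nine points gives (3 v0 - v_i)^2 <= 9 (v0^2 - v_i^2), that is 10
    v_i^2 <= 6 v0 v_i. *)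
Lemma isotropic_ge0 (I : finType) v0 (v : I -> R) i : #|I| = 10%N -> 0 <= v0 ->
    \sum_l v l = 3 * v0 -> \sum_l v l ^+ 2 = v0 ^+ 2 ->
  0 <= v i.
Proof.
move=> I10 v00 s1 s2.
have := cauchy_schwarz (fun l => if l == i then 0 else 1)
  (fun l => if l == i then 0 else v l).
have -> : \sum_l (if l == i then 0 else 1) * (if l == i then 0 else v l)
    = 3 * v0 - v i.
  rewrite -s1 (bigD1 i) //= eqxx mul0r add0r [in RHS](bigD1 i) //= [RHS]addrC addKr.
  by apply: eq_bigr => l /negPf ->; rewrite mul1r.
have -> : \sum_l (if l == i then 0 else v l) ^+ 2 = v0 ^+ 2 - v i ^+ 2.
  rewrite -s2 (bigD1 i) //= eqxx expr0n add0r [in RHS](bigD1 i) //= [RHS]addrC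
    addKr.
  by apply: eq_bigr => l /negPf ->.
have -> : \sum_l (if l == i then 0 else 1) ^+ 2 = 9 :> R.
  apply: (@addrI _ 1); rewrite (bigD1 i) //= eqxx expr0n add0r.
  rewrite (eq_bigr (fun _ => 1)); last by move=> l /negPf ->; rewrite expr1n.
  have : \sum_(l : I) 1 = 10 :> R by rewrite sumr_const I10.
  by rewrite (bigD1 i) //= => ->; ring.
nra.
Qed.

(** The reflection fixes K and preserves squares. The degree stays non-negative since (v_i + v_j +
    v_k)^2 <= 3 v0^2. *)
Lemma cremona_vec_isotropic (I : finType) (i j k : I) v0 (v : I -> R) :
    i != j -> i != k -> j != k -> 0 <= v0 ->
    \sum_l v l = 3 * v0 -> \sum_l v l ^+ 2 = v0 ^+ 2 ->
  let v' := cremona_vec i j k v0 v in let v0' := v0 + (v0 - (v i + v j + v k)) in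
  [/\ 0 <= v0', \sum_l v' l = 3 * v0' & \sum_l v' l ^+ 2 = v0' ^+ 2].
Proof.
move=> ij ik jk v00 s1 s2 v' v0'; pose t := v0 - (v i + v j + v k).
split.
- have : v i ^+ 2 + v j ^+ 2 + v k ^+ 2 <= v0 ^+ 2.
    rewrite -s2 -(@sum_triple _ i j k (fun l => v l ^+ 2)) //.
    by apply: ler_sum => l _; case: ifP => _ //; rewrite sqr_ge0.
  rewrite /v0' /t; move: (v i) (v j) (v k) => x y z h.
  have : 3 * (x ^+ 2 + y ^+ 2 + z ^+ 2) - (x + y + z) ^+ 2 >= 0.
    have -> : 3 * (x ^+ 2 + y ^+ 2 + z ^+ 2) - (x + y + z) ^+ 2 =
      (x - y) ^+ 2 + (x - z) ^+ 2 + (y - z) ^+ 2 by ring.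
    by rewrite !addr_ge0 ?sqr_ge0.
  by move=> h2; nra.
- rewrite big_split /= s1 (@sum_triple _ i j k (fun=> t)) // /v0' /t; ring.
transitivity (\sum_l v l ^+ 2 + \sum_l (if l \in [:: i; j; k] then
    2 * t * v l + t ^+ 2 else 0)).
  rewrite -big_split; apply: eq_bigr => l _; rewrite /v' /cremona_vec /=.
  by case: ifP => _; rewrite -/t; ring.
by rewrite sum_triple // s2 /v0' /t; ring.
Qed.

Lemma cremona_vecK (I : finType) (i j k : I) v0 (v : I -> R) l :
    i != j -> i != k -> j != k ->
  cremona_vec i j k (v0 + (v0 - (v i + v j + v k)))
    (cremona_vec i j k v0 v) l = v l.
Proof.
move=> ij ik jk; rewrite /cremona_vec !inE !eqxx !orbT /=.
by case: ifP => _; ring.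
Qed.

(* Cremona descent on the degree of the curve D; when no quadratic map lowers
   it, D + e K with e the least multiplicity has non-negative square, and
   pairs with v as D does since v is orthogonal to K. *)
Lemma nef10 (I : finType) v0 (v : I -> R) : #|I| = 10%N -> 0 <= v0 ->
    \sum_l v l = 3 * v0 -> \sum_l v l ^+ 2 = v0 ^+ 2 ->
  nef v0 v.
Proof.
move=> I10 v00 s1 s2 d; elim/ltn_ind: d v0 v v00 s1 s2 => d IH v0 v v00 s1 s2 m em.
case: (boolP [exists i, exists j, exists k,
    [&& i != j, i != k, j != k & (d < m i + m j + m k)%N]]).
  move=> /existsP[i /existsP[j /existsP[k /and4P[ij ik jk hM]]]].
  have [hM2 em'] := eff_cremona ij ik jk em.
  (* The reflected vector satisfies the same hypotheses, so induction applies to the curve of lower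
     degree; reflecting back restores [v]. *)
  have [v0' s1' s2'] := cremona_vec_isotropic ij ik jk v00 s1 s2.
  set w := cremona_vec i j k v0 v in s1' s2'.
  set w0 := v0 + _ in v0' s1' s2'.
  have w_ge0 l : 0 <= w l by apply: isotropic_ge0 s1' s2'.
  have lt : (2 * d - (m i + m j + m k) < d)%N by lia.
  have := cremona_pairing ij ik jk (w_ge0 i) (w_ge0 j) (w_ge0 k) hM2
    (IH _ lt w0 w v0' s1' s2' _ em').
  rewrite (eq_bigr (fun l => v l * (m l)%:R)) => [|l _]; last first.
    by rewrite cremona_vecK.
  by rewrite (_ : w0 + _ = v0) // /w0 /w /cremona_vec !inE !eqxx !orbT /=; ring.
rewrite negb_exists => /forallP h.
have htri i j k : i != j -> i != k -> j != k -> (m i + m j + m k <= d)%N.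
  move=> ij ik jk; move: (h i); rewrite negb_exists => /forallP /(_ j).
  by rewrite negb_exists => /forallP /(_ k); rewrite ij ik jk /= -leqNgt.
have [l0 hl0] : exists l0, forall l, (m l0 <= m l)%N.
  have [|x _] := @exists_notin I [::]; first by rewrite I10.
  by case: (@arg_minnP _ x predT m isT) => a _ ha; exists a => l; apply: ha.
(* D + eK has degree d - 3e and multiplicities [u], the least of them 0. *)
set e := m l0 in hl0; pose u l := (m l - e)%N.
have mE l : m l = (u l + e)%N by rewrite subnK.
have u_l0 : u l0 = 0%N by rewrite /u subnn.
have hd : (3 * e <= d)%N.
  have [|i i1] := @exists_notin I [:: l0]; first by rewrite I10.
  have [|j j1] := @exists_notin I [:: l0; i]; first by rewrite I10.
  move: i1 j1; rewrite !inE negb_or => i1 /andP[j1 j2].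
  rewrite eq_sym in i1; rewrite eq_sym in j1; rewrite eq_sym in j2.
  by have := htri l0 i j i1 j1 j2; have := hl0 i; have := hl0 j; rewrite -/e; lia.
have sq : (\sum_l u l ^ 2 <= (d - 3 * e) ^ 2)%N.
  apply: square_bound10 u_l0 _ => // i j k ij ik jk.
  by have := htri i j k ij ik jk; rewrite !mE; lia.
have vu : \sum_l v l * (u l)%:R <= v0 * (d - 3 * e)%N%:R.
  have := cauchy_schwarz v (fun l => (u l)%:R); rewrite s2.
  have sqR : \sum_l ((u l)%:R : R) ^+ 2 <= (d - 3 * e)%N%:R ^+ 2.
    rewrite -natrX; apply: le_trans (_ : (\sum_l u l ^ 2)%N%:R <= _); last first.
      by rewrite ler_nat.
    by rewrite natr_sum; under [X in _ <= X]eq_bigr => l _ do rewrite natrX.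
  set A := \sum_l v l * _; set B := (d - 3 * e)%N%:R in sqR *.
  set C := \sum_l _ in sqR *; move=> h1.
  have B0 : 0 <= B by rewrite ler0n.
  have h2 : A ^+ 2 <= (v0 * B) ^+ 2.
    by rewrite exprMn (le_trans h1) // ler_wpM2l ?sqr_ge0.
  rewrite leNgt; apply/negP => lt; move: h2; rewrite leNgt ltr_pXn2r // ?nnegrE.
    by rewrite lt.
  by rewrite mulr_ge0.
  by rewrite ltW // (le_lt_trans _ lt) // mulr_ge0.
rewrite (eq_bigr (fun l => v l * (u l)%:R + v l * e%:R)); last first.
  by move=> l _; rewrite mE natrD mulrDr.
rewrite big_split /= -mulr_suml s1; apply: le_trans (lerD vu (lexx _)) _.
by rewrite natrB // natrM; set x := d%:R; set y := e%:R; lra.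
Qed.

End Nef.

(** * Irrational isotropic vectors and Jonquieres steps *)

Section Rays.
Variables (F : numFieldType) (R : rcfType).

(* N points besides the distinguished point None, of multiplicity m0; two of
   them differ by a rational multiple of sqrt 2, which no step below alters. *)
Definition ray (N : nat) (v0 m0 : R) (M : nat) :=
  exists (J : finType) (v : option J -> R),
  [/\ #|J| = N, nef F v0 v, (forall x, 0 <= v x), v None = m0 &
    [/\ 0 <= v0, \sum_x v x = 3 * v0, \sum_x v x ^+ 2 = v0 ^+ 2 &
        exists l1 l2, v (Some l1) - v (Some l2) = (6 * M)%N%:R * Num.sqrt 2]].

Definition base_vec (M : nat) (x : option 'I_9) : R :=
  if x is Some l then 4 * M%:R ^+ 2 + 2 +
    (if l == 0 :> nat then 3 * M%:R * Num.sqrt 2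
     else if l == 1%N :> nat then - (3 * M%:R * Num.sqrt 2) else 0)
  else 9 * M%:R ^+ 2.

Lemma sqrt2_sqr : Num.sqrt 2 ^+ 2 = 2 :> R.
Proof. by rewrite sqr_sqrtr // ler0n. Qed.

Lemma base_vec_isotropic M :
  [/\ \sum_x base_vec M x = 3 * (15 * M%:R ^+ 2 + 6),
      \sum_x base_vec M x ^+ 2 = (15 * M%:R ^+ 2 + 6) ^+ 2 &
      nef F (15 * M%:R ^+ 2 + 6) (base_vec M)].
Proof.
have s1 : \sum_x base_vec M x = 3 * (15 * M%:R ^+ 2 + 6).
  by rewrite sum_option !big_ord_recl big_ord0 /=; ring.
have s2 : \sum_x base_vec M x ^+ 2 = (15 * M%:R ^+ 2 + 6) ^+ 2.
  rewrite sum_option !big_ord_recl big_ord0 /= !addr0.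
  have := sqrt2_sqr; move: (Num.sqrt 2) (M%:R) => x y e.
  rewrite !sqrrD !sqrrN !exprMn e; ring.
split=> //; apply: nef10 s1 s2; first by rewrite card_option card_ord.
by rewrite addr_ge0 ?mulr_ge0 ?sqr_ge0 ?ler0n.
Qed.

Lemma base_ray M : ray 9 (15 * M%:R ^+ 2 + 6) (9 * M%:R ^+ 2) M.
Proof.
have [s1 s2 nv] := base_vec_isotropic M.
have p0 : 0 <= 15 * M%:R ^+ 2 + 6 :> R.
  by rewrite addr_ge0 ?mulr_ge0 ?sqr_ge0 ?ler0n.
exists 'I_9, (base_vec M); split=> //; first by rewrite card_ord.
  move=> x; apply: isotropic_ge0 s1 s2 => //.
  by rewrite card_option card_ord.
split=> //; exists (@Ordinal 9 0 isT), (@Ordinal 9 1 isT).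
by rewrite /= natrM; ring.
Qed.

Definition pad2 (J : finType) (v : option J -> R) (x : option (option (option
  J))) :=
  match x with None => v None | Some None => 0 | Some (Some None) => 0
  | Some (Some (Some l)) => v (Some l) end.

(** The Cremona map is based at [None] and two new points of multiplicity 0: with h = v0 - m0 these
    acquire h, and [None] acquires m0 + h = v0. *)
Lemma ray_jonquieres N v0 m0 M : ray N v0 m0 M -> ray N.+2 (v0 + (v0 - m0)) v0 M.
Proof.
case=> J [v [cJ nv v_ge0 vN [v00 s1 s2 [l1 [l2 hl]]]]].
pose w := pad2 v.
have ws (g : R -> R) : g 0 = 0 -> \sum_x g (w x) = \sum_x g (v x).
  by move=> g0; rewrite !sum_option /= g0 !add0r.
have nw : nef F v0 w.
  apply: (@nef_inj F R _ _ (fun x : option J => if x is Some l then Some (Some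
    (Some l)) else None)) nv.
  - by move=> [x|] [y|] //= [->].
  - by case.
  case=> [[[l|]|]|] //= h; first by have := h (Some l); rewrite eqxx.
  by have := h None; rewrite eqxx.
pose i : option (option (option J)) := None.
pose j : option (option (option J)) := Some None.
pose k : option (option (option J)) := Some (Some None).
have w_ge0 x : 0 <= w x by case: x => [[[l|]|]|] /=.
have ws1 : \sum_x w x = 3 * v0 by rewrite (ws id).
have ws2 : \sum_x w x ^+ 2 = v0 ^+ 2.
  by rewrite (ws (fun x => x ^+ 2)) ?s2 ?expr0n.
(* m0^2 is one term of a sum of squares equal to v0^2; hence h >= 0 and multiplicities stay
   non-negative. *)
have m0v0 : m0 <= v0.
  rewrite -[v0]ger0_norm // -[m0]ger0_norm -?vN // -ler_sqr ?nnegrE //.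
  by rewrite !real_normK ?num_real // -s2 sum_option lerDl sumr_ge0 // => l _;
    rewrite sqr_ge0.
have [p0 t1 t2] := @cremona_vec_isotropic R _ i j k v0 w isT isT isT v00 ws1 ws2.
have e0 : v0 + (v0 - (w i + w j + w k)) = v0 + (v0 - m0) by rewrite /= vN !addr0.
have := @nef_cremona F R _ i j k v0 w isT isT isT (w_ge0 _) (w_ge0 _) (w_ge0 _) nw.
rewrite e0 in p0 t1 t2 * => nw'.
exists (option (option J)), (cremona_vec i j k v0 w); split=> //.
- by rewrite !card_option cJ.
- case=> [[[l|]|]|]; rewrite /cremona_vec !inE /= ?addr0 ?vN //.
  + by rewrite add0r subr_ge0.
  + by rewrite add0r subr_ge0.
  by rewrite addrC subrK.
- by rewrite /cremona_vec !inE /= vN !addr0 addrC subrK.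
by split=> //; exists (Some (Some l1)), (Some (Some l2));
  rewrite /cremona_vec !inE /= !addr0.
Qed.

(** The difference v0 - m0 is invariant under the step, so growth is linear. *)
Lemma ray_iter n N v0 m0 M : ray N v0 m0 M ->
  ray (N + 2 * n) (v0 + n%:R * (v0 - m0)) (m0 + n%:R * (v0 - m0)) M.
Proof.
move=> h; elim: n => [|n /ray_jonquieres]; first by rewrite addn0 !mul0r !addr0.
have -> : (N + 2 * n).+2 = (N + 2 * n.+1)%N by lia.
have -> : v0 + n%:R * (v0 - m0) + (v0 + n%:R * (v0 - m0) - (m0 + n%:R * (v0 - m0)))
  = v0 + n.+1%:R * (v0 - m0) by rewrite -natr1; ring.
by have -> : v0 + n%:R * (v0 - m0) = m0 + n.+1%:R * (v0 - m0) by rewrite -natr1;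
  ring.
Qed.

Definition pad1 (J : finType) (v : option J -> R) (x : option (option J)) :=
  match x with None => v None | Some None => 0 | Some (Some l) => v (Some l) end.

Lemma ray14 M : ray 10 (17 * M%:R ^+ 2 + 10) (11 * M%:R ^+ 2 + 4) M.
Proof.
have [s1 s2 nv] := base_vec_isotropic M.
set v := base_vec M in s1 s2 nv; set v0 := 15 * _ + 6 in s1 s2 nv.
have M2 : 0 <= M%:R ^+ 2 :> R by rewrite sqr_ge0.
have p0 : 0 <= v0 by rewrite /v0; lra.
have v_ge0 x : 0 <= v x.
  by apply: isotropic_ge0 s1 s2 => //; rewrite card_option card_ord.
pose w := pad1 v.
have ws (g : R -> R) : g 0 = 0 -> \sum_x g (w x) = \sum_x g (v x).
  by move=> g0; rewrite !sum_option /= g0 !add0r.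
have nw : nef F v0 w.
  apply: (@nef_inj F R _ _ (fun x => if x is Some l then Some (Some l) else
    None)) nv.
  - by move=> [x|] [y|] //= [->].
  - by case.
  case=> [[l|]|] //= h; first by have := h (Some l); rewrite eqxx.
  by have := h None; rewrite eqxx.
pose i : option (option 'I_9) := None.
pose j : option (option 'I_9) := Some None.
(* Index 2 avoids the two points carrying sqrt 2; its multiplicity 4M^2 + 2 makes the increment 2M^2
   + 4. *)
pose k : option (option 'I_9) := Some (Some (@Ordinal 9 2 isT)).
have w_ge0 x : 0 <= w x.
  by case: x => [[l|]|]; [apply: (v_ge0 (Some l))|apply: lexx|apply: (v_ge0 None)].
have ws1 : \sum_x w x = 3 * v0 by rewrite (ws id).
have ws2 : \sum_x w x ^+ 2 = v0 ^+ 2.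
  by rewrite (ws (fun x => x ^+ 2)) ?s2 ?expr0n.
have [q0 t1 t2] := @cremona_vec_isotropic R _ i j k v0 w isT isT isT p0 ws1 ws2.
have e0 : v0 + (v0 - (w i + w j + w k)) = 17 * M%:R ^+ 2 + 10.
  by rewrite /= /v0; ring.
have := @nef_cremona F R _ i j k v0 w isT isT isT (w_ge0 _) (w_ge0 _) (w_ge0 _) nw.
rewrite e0 in q0 t1 t2 * => nw'.
have t_ge0 : 0 <= v0 - (w i + w j + w k) by rewrite /= /v0; lra.
exists (option 'I_9), (cremona_vec i j k v0 w); split=> //.
- by rewrite card_option card_ord.
- move=> x; rewrite /cremona_vec; apply: addr_ge0; first exact: w_ge0.
  by case: ifP => _; [exact: t_ge0|exact: lexx].
- by rewrite /cremona_vec !inE /= /v0; ring.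
split=> //; exists (Some (@Ordinal 9 0 isT)), (Some (@Ordinal 9 1 isT)).
by rewrite /cremona_vec !inE /= natrM; ring.
Qed.
End Rays.

(** * From nef vectors to wonderful rays *)

Section Wonderful.

Definition posp (z : int) : nat := if z is Posz n then n else 0.

Lemma taylor_coefE d c p a b : taylor_coef d c p a b = taylor d c p a b.
Proof. by []. Qed.

(** [effective] speaks of distinct points only. Shifting the l-th first coordinate by l times the
    parameter separates the points generically, and specialisation at 0 reaches every
    configuration. *)
Lemma effective_eff s (d : int) (m : 'I_s -> int) : effective d m ->
  0 <= d /\ eff CC `|d|%N (fun l => posp (m l)).
Proof.
case=> d0 h; split=> // p.
pose P (l : 'I_s) : {poly CC} * {poly CC} :=
  ((p l).1%:P + (l%:R)%:P * 'X, (p l).2%:P).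
pose q : {poly CC} := \prod_(u : 'I_s * 'I_s | u.1 != u.2)
  ((p u.1).1%:P + (u.1%:R)%:P * 'X - ((p u.2).1%:P + (u.2%:R)%:P * 'X)).
have P0 : at_param P 0 = p.
  apply: funext => l; rewrite /at_param /P /= hornerD hornerM !hornerC hornerX.
  by rewrite mulr0 addr0 -surjective_pairing.
rewrite -P0; apply: (@curve_specialize _ _ _ _ P q) => [|e].
  apply/prodf_neq0 => -[i j] /= ij.
  apply/eqP => /(congr1 (fun r : {poly CC} => r`_1)).
  rewrite coef0 coefB !coefD !coefC /= !add0r !coefCM coefX /= !mulr1.
  by move/eqP; rewrite subr_eq0 eqr_nat => /eqP/val_inj/eqP; rewrite (negPf ij).
rewrite horner_prod => /prodf_neq0 qe; apply/curveP.
have [|c [sc [i [j c0]] ht]] := h (at_param P e).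
  move=> i j; rewrite /at_param /P /= => -[e1 _]; apply/eqP; apply: contraT => ij.
  by have := qe (i, j) ij; rewrite /= hornerD hornerN e1 subrr eqxx.
exists c; split=> //; first by exists i, j.
move=> l a b hab; rewrite -taylor_coefE; apply: (ht l).
by move: hab; case: (m l).
Qed.

(** Replacing a negative multiplicity by 0 only lowers the pairing, as [v] has non-negative
    multiplicities. *)
Lemma nef_nef_ray s (v : NS s) : (forall i, 0 <= v.2 i) -> nef CC v.1 v.2 ->
  nef_ray v.
Proof.
move=> v0 nv d m /effective_eff[d0 em]; rewrite /dotN /classN /= subr_ge0.
have {em} := nv _ _ em; case: d d0 => // d _ /=.
apply: le_trans; apply: ler_sum => i _; rewrite ler_wpM2l //.
case: (m i) => n //=; rewrite NegzE.
by rewrite mulrNz oppr_le0 ler0n.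
Qed.

Lemma sqrt2_irrational (a b : int) :
  a%:~R = b%:~R * Num.sqrt 2 :> RR -> b = 0.
Proof.
move=> e; have : (a * a)%:~R = (b * b * 2)%:~R :> RR.
  by rewrite !intrM e mulrACA -expr2 -[X in _ * X = _]expr2 sqr_sqrtr ?ler0n.
move/intr_inj/(congr1 absz); rewrite !abszM => en.
apply/eqP; rewrite -absz_eq0; apply: contraT; rewrite -lt0n => b0.
have a0 : (0 < `|a|)%N by move: en; case: (`|a|%N) => //; lia.
(* In a^2 = 2 b^2 the 2-adic valuations have different parity. *)
have := congr1 (logn 2) en; rewrite !lognM ?muln_gt0 ?b0 //.
have -> : logn 2 `|2%:Z| = 1%N by [].
lia.
Qed.

(** Absent points get multiplicity 0. Since the degree is a positive integer and two multiplicities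
    differ by a nonzero integer multiple of sqrt 2, an integral multiple of the vector would make
    sqrt 2 rational. *)
Lemma wonderful_of_nef (I : finType) s (V0 r : nat) (v : I -> RR) :
    (#|I| <= s)%N -> (0 < V0)%N -> (0 < r)%N -> nef CC V0%:R v ->
    (forall l, 0 <= v l) -> \sum_l v l ^+ 2 = V0%:R ^+ 2 ->
    (exists l1 l2, v l1 - v l2 = r%:R * Num.sqrt 2) ->
  exists w : NS s, [/\ wonderful w, w.1 = V0%:R & \sum_i w.2 i = \sum_l v l].
Proof.
move=> Is V0p rp nv v0 s2 [l1 [l2 hl]].
pose f (l : I) := widen_ord Is (enum_rank l).
have fi : injective f.
  by move=> x y /(congr1 val) /= h; apply: enum_rank_inj; apply: val_inj.
pose w i := if [pick l | f l == i] is Some l then v l else 0.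
have wf l : w (f l) = v l.
  rewrite /w; case: pickP => [l' /eqP/fi -> //|/(_ l)]; by rewrite eqxx.
have w0 j : (forall l, f l != j) -> w j = 0.
  by move=> h; rewrite /w; case: pickP => // l; rewrite (negPf (h l)).
have w_ge0 i : 0 <= w i by rewrite /w; case: pickP.
have V0R : 0 < V0%:R :> RR by rewrite ltr0n.
exists (V0%:R, w); split=> //; last first.
  by rewrite /= (sum_inj fi) //; apply: eq_bigr => l _; rewrite wf.
split.
- by left; rewrite /= gt_eqF.
- by apply: nef_nef_ray => /=; last exact: (nef_inj fi wf w0 nv).
- case=> l [d [m [l0 ld lm]]] /=.
  have e : (V0%:Z * (m (f l1) - m (f l2)))%:~R = (d * r%:Z)%:~R * Num.sqrt 2 :> RR.
    rewrite !rmorphM rmorphB /= -!lm -ld /= !wf -mulrBr hl -!pmulrn; ring.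
  have /eqP := sqrt2_irrational e; rewrite mulf_eq0 => /orP[/eqP d0|/eqP].
    by move: ld; rewrite d0 /= => /eqP; rewrite mulf_eq0 !gt_eqF.
  by case: r rp {hl e}.
rewrite /dotN /=; apply/eqP; rewrite subr_eq0; apply/eqP; rewrite -expr2 -s2.
rewrite (sum_inj fi) => [|j /w0 ->]; last by rewrite mul0r.
by apply: eq_bigr => l _; rewrite wf.
Qed.

(** Spreading m0 over k^2 points of multiplicity m0 / k keeps the sum of squares and raises the sum
    by (k - 1) m0. *)
Lemma wonderful_of_ray N (V0 : nat) (m0 : RR) M k s :
    (0 < V0)%N -> (0 < M)%N -> (0 < k)%N -> (N + k ^ 2 <= s)%N ->
    ray CC N V0%:R m0 M ->
  exists w : NS s, [/\ wonderful w, w.1 = V0%:R &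
    \sum_i w.2 i = 3 * V0%:R + (k%:R - 1) * m0].
Proof.
move=> V0p Mp kp hs [J [v [cJ nv v_ge0 vN [v00 s1 s2 [l1 [l2 hl]]]]]].
have kR : k%:R != 0 :> RR by rewrite pnatr_eq0 -lt0n.
have vN0 : 0 <= m0 by rewrite -vN.
pose u (x : J + 'I_k * 'I_k) := if x is inl l then v (Some l) else v None / k%:R.
have su (g : RR -> RR) : \sum_x g (u x) =
    \sum_l g (v (Some l)) + (k ^ 2)%N%:R * g (m0 / k%:R).
  rewrite big_sumType /= vN; congr (_ + _); rewrite sumr_const card_prod card_ord.
  by rewrite mulr_natl.
have [|||||||w [ww w1 w2]] := @wonderful_of_nef _ s V0 (6 * M) u.
- by rewrite card_sum card_prod !card_ord cJ.
- by [].
- by lia.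
- by apply: nef_collide; rewrite ?vN.
- by case=> [l|g] //=; rewrite vN divr_ge0.
- rewrite (su (fun x => x ^+ 2)) -s2 sum_option vN [RHS]addrC; congr (_ + _).
  by rewrite natrX -exprMn mulrC divfK.
- by exists (inl l1), (inl l2).
exists w; split=> //; rewrite w2 (su id) -s1 sum_option vN natrX.
by field.
Qed.

Lemma wonderful_deFernex N (V0 : nat) (m0 : RR) M k s :
    (0 < V0)%N -> (0 < M)%N -> (0 < k)%N -> (N + k ^ 2 <= s)%N ->
    ray CC N V0%:R m0 M -> 0 <= m0 ->
    (s - 1)%N%:R * V0%:R ^+ 2 < (3 * V0%:R + (k%:R - 1) * m0) ^+ 2 ->
  exists w : NS s, wonderful w /\ dotN w (deFernexN s) < 0.
Proof.
move=> V0p Mp kp hs hr m00 lt.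
have [w [ww w1 w2]] := wonderful_of_ray V0p Mp kp hs hr; exists w; split=> //.
rewrite /dotN /deFernexN /= w1 subr_lt0.
under [X in _ < X]eq_bigr => i _ do rewrite mulr1.
have k1 : 0 <= k%:R - 1 :> RR by rewrite subr_ge0 ler1n.
rewrite w2 -(@ltr_pXn2r _ 2) // ?nnegrE.
- by rewrite exprMn sqr_sqrtr ?ler0n // mulrC.
- by rewrite mulr_ge0 ?sqrtr_ge0 ?ler0n.
by rewrite addr_ge0 ?mulr_ge0 ?ler0n.
Qed.

Lemma iterated_base_ray n M :
  ray CC (9 + 2 * n) ((15 * M ^ 2 + 6 + n * (6 * M ^ 2 + 6))%N%:R : RR)
    ((9 * M ^ 2 + n * (6 * M ^ 2 + 6))%N%:R : RR) M.
Proof.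
have := ray_iter n (base_ray CC RR M).
rewrite !(natrD, natrM, natrX).
by congr (ray _ _ _ _ _); ring.
Qed.

End Wonderful.

Theorem mainTheorem1 :
  [/\ (forall s : nat, (10 <= s)%N -> exists v : NS s, wonderful v),
      (forall s : nat, (13 <= s)%N ->
         exists v : NS s, wonderful v /\ 0 < dotN v (canonicalN s)),
      (exists v : NS 14, wonderful v /\ dotN v (deFernexN 14) < 0),
      (forall s : nat, (13 <= s)%N -> (exists k : nat, (s - 4)%N = (k ^ 2)%N) ->
         exists v : NS s, wonderful v /\ dotN v (deFernexN s) < 0) &
      (forall s : nat, (18 <= s)%N -> (exists k : nat, (s - 2)%N = (k ^ 2)%N) ->
         exists v : NS s, wonderful v /\ dotN v (deFernexN s) < 0)].
Proof.
(* The vector (21; 9, 6 + 3 sqrt 2, 6 - 3 sqrt 2, 6^7) on ten points. *)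
have b1 := iterated_base_ray 0 1.
split.
- move=> s hs;
  have [||||w [ww _ _]] := @wonderful_of_ray _ _ _ _ 1 s _ _ _ _ b1 => //.
  by exists w.
(* Spreading the 9 over four points uses 13 points and gives R.K = 9. *)
- move=> s hs;
  have [||||w [ww w1 w2]] := @wonderful_of_ray _ _ _ _ 2 s _ _ _ _ b1 => //.
  exists w; split=> //; rewrite /dotN /canonicalN /= w1.
  under eq_bigr => i _ do rewrite mulrN1.
  by rewrite sumrN w2 !(natrD, natrM, natrX); lra.
(* The leading terms satisfy 13 * 17^2 < (3 * 17 + 11)^2, so a large M works; for M = 5, 13 * 435^2
   = 2459925 < 1584^2 = 2509056. *)
- have h := ray14 CC RR 5.
  have e1 : 17 * 5%:R ^+ 2 + 10 = 435%N%:R :> RR by ring.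
  have e2 : 11 * 5%:R ^+ 2 + 4 = 279%N%:R :> RR by ring.
  rewrite e1 e2 in h.
  apply: (wonderful_deFernex _ _ (k := 2) _ _ h) => //.
  by rewrite (_ : (14 - 1 = 13)%N) //; lra.
- move=> s hs [k hk].
  (* j Jonquieres steps and (j + 2)^2 points in the grid use exactly (j + 3)^2 + 4 points. *)
  have [j ek] : exists j, k = (j + 3)%N by exists (k - 3)%N; nia.
  have -> : s = ((j + 3) ^ 2 + 4)%N by rewrite -ek; lia.
  have side : (9 + 2 * j + (j + 2) ^ 2 <= (j + 3) ^ 2 + 4)%N by nia.
  apply: (wonderful_deFernex _ _ _ side (iterated_base_ray j (j + 3))); try lia.
    by rewrite ler0n.
  rewrite (_ : ((j + 3) ^ 2 + 4 - 1) = (j + 3) ^ 2 + 3)%N; last by lia.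
  have : 0 <= j%:R :> RR by rewrite ler0n.
  rewrite !(natrD, natrM, natrX); move: (j%:R) => x x0.
  rewrite -subr_gt0.
  (* Expanded in x = j >= 0, the difference has only positive coefficients; likewise in the last
     case. *)
  rewrite (_ : _ - _ = 18 * (858 + 1293 * x ^+ 1 + 792 * x ^+ 2
      + 252 * x ^+ 3 + 42 * x ^+ 4 + 3 * x ^+ 5));
    last by ring.
  move: (exprn_ge0 1 x0) (exprn_ge0 2 x0) (exprn_ge0 3 x0) (exprn_ge0 4 x0).
  by move: (exprn_ge0 5 x0) => *; lra.
- move=> s hs [k hk].
  (* Here j steps and (j + 3)^2 grid points use exactly (j + 4)^2 + 2 points; s >= 18 gives k >=
     4. *)
  have [j ek] : exists j, k = (j + 4)%N by exists (k - 4)%N; nia.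
  have -> : s = ((j + 4) ^ 2 + 2)%N by rewrite -ek; lia.
  have side : (9 + 2 * j + (j + 3) ^ 2 <= (j + 4) ^ 2 + 2)%N by nia.
  apply: (wonderful_deFernex _ _ _ side (iterated_base_ray j (j + 4))); try lia.
    by rewrite ler0n.
  rewrite (_ : ((j + 4) ^ 2 + 2 - 1) = (j + 4) ^ 2 + 1)%N; last by lia.
  have : 0 <= j%:R :> RR by rewrite ler0n.
  rewrite !(natrD, natrM, natrX); move: (j%:R) => x x0.
  rewrite -subr_gt0.
  rewrite (_ : _ - _ = 18 * (1328 + 1960 * x ^+ 1 + 1150 * x ^+ 2
      + 338 * x ^+ 3 + 50 * x ^+ 4 + 3 * x ^+ 5));
    last by ring.
  move: (exprn_ge0 1 x0) (exprn_ge0 2 x0) (exprn_ge0 3 x0) (exprn_ge0 4 x0).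
  by move: (exprn_ge0 5 x0) => *; lra.
Qed.
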